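(* Let $\Gamma$ be a vertex- and arc-transitive two-ended digraph and $G=\mathrm{Aut}(\Gamma)$. Let $N$ be a normal subgroup of $G$ with finite orbits on $V\Gamma$ such that either (i) $\Gamma/N\cong\mathbb Z$ and $G/N\cong D_\infty$, or (ii) $\Gamma/N\cong\vec{\mathbb Z}$ and $G/N\cong\mathbb Z$ (such an $N$ always exists). Let $\varphi$ be the surjective digraph homomorphism from $\Gamma$ onto the digraph $\mathbb Z$ in case (i), respectively onto $\vec{\mathbb Z}$ in case (ii), obtained by composing the quotient map $\Gamma\to\Gamma/N$ with such an isomorphism, and set $\Gamma_i=\varphi^{-1}(i)$ for $i\in\mathbb Z$. Then: (a) Case (i) occurs precisely when every vertex $v$ in $\Gamma_i$ (for every $i$) has both in-neighbours and out-neighbours in each of $\Gamma_{i-1}$ and $\Gamma_{i+1}$. In this case the number of out-neighbours of $v$ in $\Gamma_{i-1}$ is the same as the number of out-neighbours in $\Gamma_{i+1}$, and the same holds for the numbers of in-neighbours; and the subdigraph spanned by $\Gamma_i\cup\Gamma_{i+1}$ is bipartite (i.e. its underlying undirected graph is bipartite) and is both vertex- and arc-transitive. (b) Case (ii) occurs precisely when every vertex $v$ in $\Gamma_i$ (for every $i$) has all of its in-neighbours in $\Gamma_{i-1}$ and all of its out-neighbours in $\Gamma_{i+1}$. In this case the subdigraph spanned by $\Gamma_i\cup\Gamma_{i+1}$ is bipartite and arc-transitive, and all its arcs have their initial vertex in $\Gamma_i$ and terminal vertex in $\Gamma_{i+1}$. (c) The in-valency of $\Gamma$ is equal to the out-valency.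 (d) If the out-valency of $\Gamma$ is odd, then $\Gamma$ has Property Z. (e) If $\Gamma$ is 2-arc-transitive, then $\Gamma/N\cong\vec{\mathbb Z}$ and $\Gamma$ has Property Z. (f) If $\Gamma$ is locally quasi-primitive and the stabilizer in $G$ of a vertex has more than 2 elements, then $\Gamma$ has Property Z. (g) Suppose that the out-valency is 2. If the stabilizer in $G$ of a vertex has more than 2 elements, then $\Gamma$ has Property Z.
   Context: A digraph $\Gamma=(V\Gamma,E\Gamma)$ has vertex set $V\Gamma$ and arc set $E\Gamma\subseteq V\Gamma\times V\Gamma$; both $(v,w)$ and $(w,v)$ may be arcs. It is connected if its underlying undirected graph is connected. For a vertex $v$, $\mathrm{in}(v)=\{u:(u,v)\in E\Gamma\}$ (in-neighbours) and $\mathrm{out}(v)=\{u:(v,u)\in E\Gamma\}$ (out-neighbours); their cardinalities are the in-valency and out-valency. $\Gamma$ is vertex-transitive (arc-transitive, 2-arc-transitive) if $\mathrm{Aut}(\Gamma)$ is transitive on vertices (arcs, 2-arcs), where a 2-arc is a sequence $v_0,v_1,v_2$ with $(v_0,v_1),(v_1,v_2)\in E\Gamma$. The subdigraph spanned by a set of vertices is the induced subdigraph. A ray is a one-way infinite path (in the underlying undirected graph) with distinct vertices. The ends of a digraph are the equivalence classes of rays, where two rays are equivalent if there is an infinite family of pairwise disjoint paths (ignoring directions) each having its initial vertex in one ray and terminal vertex in the other. A digraph is two-ended if it is connected and has exactly two ends; two-ended vertex-transitive digraphs are locally finite. The symbol $\mathbb Z$ denotes both the group of integers and the digraph with vertex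 set $\mathbb Z$ and arcs $(i,i+1)$ and $(i+1,i)$ for all $i\in\mathbb Z$; $\vec{\mathbb Z}$ is the digraph with vertex set $\mathbb Z$ and arcs $(i,i+1)$ for all $i\in\mathbb Z$. $D_\infty$ is the infinite dihedral group. For a subgroup $N\le\mathrm{Aut}(\Gamma)$, the quotient digraph $\Gamma/N$ has the $N$-orbits on $V\Gamma$ as vertices, and $(A,B)$ is an arc of $\Gamma/N$ iff there are $v\in A$, $w\in B$ with $(v,w)\in E\Gamma$. A digraph homomorphism is a map on vertices sending arcs to arcs (preserving direction). A connected digraph $\Gamma$ has Property Z if there is a surjective digraph homomorphism $\Gamma\to\vec{\mathbb Z}$. A transitive group action is quasi-primitive if every normal subgroup acts either trivially or transitively. A vertex-transitive digraph $\Gamma$ is locally quasi-primitive if the stabilizer of a vertex $v$ in $\mathrm{Aut}(\Gamma)$ acts quasi-primitively on both $\mathrm{in}(v)$ and $\mathrm{out}(v)$. *)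

(* Defs.v *)
From HB Require Import structures.
From mathcomp Require Import all_boot all_algebra.
From mathcomp Require Import boolp classical_sets functions cardinality.

Set Implicit Arguments.
Unset Strict Implicit.
Unset Printing Implicit Defensive.

Import GRing.Theory.

Local Open Scope classical_set_scope.
Local Open Scope group_scope.

(* MathComp, with classical logic from mathcomp-classical. In particular the
   boolean relations below are arbitrary relations. *)

Record digraph := Digraph { vertex :> choiceType; is_arc : rel vertex }.

Section Digraphs.
Variable Γ : digraph.
Implicit Types (u v w : Γ) (r s : nat -> Γ).

Definition in_nbrs v : set Γ := [set u | is_arc u v].
Definition out_nbrs v : set Γ := [set u | is_arc v u].

Definition has_out_valency (d : nat) : Prop :=
  forall v, (out_nbrs v #= `I_d)%card.

Definition adj : rel Γ := [rel u v | is_arc u v || is_arc v u].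

Definition connected : Prop :=
  forall u v, exists2 p : seq Γ, path adj u p & last u p = v.

Definition bipartite : Prop :=
  exists c : Γ -> bool, forall u v, adj u v -> c u != c v.

Definition is_ray r : Prop := injective r /\ forall n, adj (r n) (r n.+1).

(* The n-th path of the family has vertex sequence [x n :: p n]; paths of
   length zero are allowed. *)
Definition ray_equiv r s : Prop :=
  exists (x : nat -> Γ) (p : nat -> seq Γ),
    (forall n, [/\ path adj (x n) (p n), uniq (x n :: p n),
                   range r (x n) & range s (last (x n) (p n))]) /\
    (forall m n, m != n ->
       forall z, z \in x m :: p m -> z \notin x n :: p n).

Definition ends : set (set (nat -> Γ)) :=
  [set [set s | is_ray s /\ ray_equiv r s] | r in is_ray].

Definition two_ended : Prop := connected /\ (ends #= `I_2)%card.

Definition induced (A : set Γ) : digraph :=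
  @Digraph (set_type A : choiceType) (fun x y => is_arc (val x) (val y)).

End Digraphs.

Definition digraph_hom (Γ Δ : digraph) (f : Γ -> Δ) : Prop :=
  forall u v, is_arc u v -> is_arc (f u) (f v).

Definition digraph_isom (Γ Δ : digraph) (f : Γ -> Δ) : Prop :=
  bijective f /\ forall u v, is_arc (f u) (f v) = is_arc u v.

Definition digraph_isomorphic (Γ Δ : digraph) : Prop :=
  exists f : Γ -> Δ, digraph_isom f.

Definition Zdigraph : digraph :=
  @Digraph int (fun i j => (j == i + 1)%R || (i == j + 1)%R).

Definition Zvec : digraph := @Digraph int (fun i j => (j == i + 1)%R).

Definition property_Z (Γ : digraph) : Prop :=
  connected Γ /\ exists f : Γ -> Zvec, digraph_hom f /\ range f = [set: Zvec].

Record aut (Γ : digraph) :=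
  Aut { aut_fun :> Γ -> Γ; autP : `[< digraph_isom aut_fun >] }.

HB.instance Definition _ Γ := [isSub for @aut_fun Γ].
HB.instance Definition _ Γ := [Choice of aut Γ by <:].

Section AutGroup.
Variable Γ : digraph.
Implicit Types f g h : aut Γ.

Lemma aut_ext f g : f =1 g -> f = g.
Proof. by move=> fg; apply/val_inj/funext. Qed.

Fact aut_one_subproof : `[< digraph_isom (@id Γ) >].
Proof. by apply/asboolP; split=> //; exists id. Qed.

Fact aut_mul_subproof f g : `[< digraph_isom (f \o g) >].
Proof.
have /asboolP[bf af] := autP f; have /asboolP[bg ag] := autP g.
by apply/asboolP; split=> [|u v]; [apply: bij_comp | rewrite /= af ag].
Qed.

Lemma aut_can f : {f' : Γ -> Γ | cancel f f' & cancel f' f}.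
Proof.
by apply: cid2; have /asboolP[[f' fK Kf] _] := autP f; exists f'.
Qed.

Definition aut_inv_fun f : Γ -> Γ := s2val (aut_can f).

Lemma aut_funK f : cancel f (aut_inv_fun f).
Proof. exact: (s2valP (aut_can f)). Qed.

Lemma aut_inv_funK f : cancel (aut_inv_fun f) f.
Proof. exact: (s2valP' (aut_can f)). Qed.

Fact aut_inv_subproof f : `[< digraph_isom (aut_inv_fun f) >].
Proof.
have /asboolP[_ af] := autP f; apply/asboolP; split=> [|u v].
  by exists f; [apply: aut_inv_funK | apply: aut_funK].
by rewrite -af !aut_inv_funK.
Qed.

Definition aut_one := Aut aut_one_subproof.
Definition aut_mul f g := Aut (aut_mul_subproof f g).
Definition aut_inv f := Aut (aut_inv_subproof f).

Fact aut_mulA : associative aut_mul.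
Proof. by move=> f g h; apply: aut_ext. Qed.

Fact aut_mul1 : left_id aut_one aut_mul.
Proof. by move=> f; apply: aut_ext. Qed.

Fact aut_mulr1 : right_id aut_one aut_mul.
Proof. by move=> f; apply: aut_ext. Qed.

Fact aut_mulV : left_inverse aut_one aut_inv aut_mul.
Proof. by move=> f; apply: aut_ext => v /=; rewrite aut_funK. Qed.

Fact aut_mulrV : right_inverse aut_one aut_inv aut_mul.
Proof. by move=> f; apply: aut_ext => v /=; rewrite aut_inv_funK. Qed.

(* [f * g] is the composite [f \o g]. *)
HB.instance Definition _ :=
  isGroup.Build (aut Γ) aut_mulA aut_mul1 aut_mulr1 aut_mulV aut_mulrV.

End AutGroup.

Definition group_isomorphic (G H : groupType) : Prop :=
  exists f : {multiplicative G -> H}, bijective f.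

Definition is_normal_in (G : groupType) (N H : set G) : Prop :=
  [/\ N `<=` H, group_closed [in N] & forall x y, N x -> H y -> N (x ^ y)].

Record normal_subgroup (G : groupType) := NormalSubgroup
  { normal_set :> set G; normalP : is_normal_in normal_set [set: G] }.

Record left_coset (G : groupType) (N : set G) := Coset
  { coset_set : set G;
    left_cosetP : `[< exists x, coset_set = [set x * n | n in N] >] }.

HB.instance Definition _ G N := [isSub for @coset_set G N].
HB.instance Definition _ G N := [Choice of @left_coset G N by <:].

Section QuotientGroup.
Variables (G : groupType) (N : normal_subgroup G).

Fact lcoset_subproof (x : G) :
  `[< exists y, [set x * n | n in N] = [set y * n | n in N] >].
Proof. by apply/asboolP; exists x. Qed.

Definition to_coset (x : G) : left_coset N := Coset (lcoset_subproof x).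

Lemma nsub1 : normal_set N 1.
Proof. by have [_ [/set_mem]] := normalP N. Qed.

Lemma nsubM x y : normal_set N x -> normal_set N y -> normal_set N (x * y).
Proof.
have [_ /group_closedM NM _] := normalP N => Nx Ny.
by apply/set_mem/NM; apply/mem_set.
Qed.

Lemma nsubV x : normal_set N x -> normal_set N x^-1.
Proof.
have [_ /group_closedV NV _] := normalP N => Nx.
by apply/set_mem/NV; apply/mem_set.
Qed.

Lemma nsubJ x y : normal_set N x -> normal_set N (x ^ y).
Proof. by have [_ _ NJ] := normalP N => Nx; apply: NJ. Qed.

Lemma coset_ext (A B : left_coset N) : coset_set A = coset_set B -> A = B.
Proof. by move=> AB; apply: val_inj. Qed.

Lemma to_coset_surj A : exists x, A = to_coset x.
Proof. by have /asboolP[x Ax] := left_cosetP A; exists x; apply: coset_ext. Qed.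

Lemma to_coset_setM x y :
  [set a * b | a in coset_set (to_coset x) & b in coset_set (to_coset y)]
  = coset_set (to_coset (x * y)).
Proof.
apply/seteqP; split=> [_ [_ [m Nm <-]] [_ [n Nn <-]] <-|_ [n Nn <-]] /=.
  exists (m ^ y * n); first by apply: nsubM => //; apply: nsubJ.
  by rewrite /conjg !mulgA mulgK.
exists x; first by exists 1; [apply: nsub1 | rewrite mulg1].
by exists (y * n); [exists n | rewrite mulgA].
Qed.

Lemma to_coset_setV x :
  [set a^-1 | a in coset_set (to_coset x)] = coset_set (to_coset x^-1).
Proof.
apply/seteqP; split=> [_ [_ [n Nn <-] <-]|_ [n Nn <-]] /=.
  exists (n^-1 ^ x^-1); first by apply/nsubJ/nsubV.
  by rewrite /conjg invgK !mulgA mulVg mul1g invgM.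
exists (n^-1 * x); last by rewrite invgM invgK.
exists (n^-1 ^ x); first by apply/nsubJ/nsubV.
by rewrite /conjg mulgA mulgV mul1g.
Qed.

Fact coset_mul_subproof (A B : left_coset N) :
  `[< exists x, [set a * b | a in coset_set A & b in coset_set B]
                = [set x * n | n in N] >].
Proof.
have [x ->] := to_coset_surj A; have [y ->] := to_coset_surj B.
by apply/asboolP; exists (x * y); apply: to_coset_setM.
Qed.

Fact coset_inv_subproof (A : left_coset N) :
  `[< exists x, [set a^-1 | a in coset_set A] = [set x * n | n in N] >].
Proof.
have [x ->] := to_coset_surj A.
by apply/asboolP; exists x^-1; apply: to_coset_setV.
Qed.

Definition coset_one : left_coset N := to_coset 1.
Definition coset_mul A B : left_coset N := Coset (coset_mul_subproof A B).
Definition coset_inv A : left_coset N := Coset (coset_inv_subproof A).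

Lemma to_cosetM x y : coset_mul (to_coset x) (to_coset y) = to_coset (x * y).
Proof. exact/coset_ext/to_coset_setM. Qed.

Lemma to_cosetV x : coset_inv (to_coset x) = to_coset x^-1.
Proof. exact/coset_ext/to_coset_setV. Qed.

Fact coset_mulA : associative coset_mul.
Proof.
move=> A B C; have [x ->] := to_coset_surj A; have [y ->] := to_coset_surj B.
by have [z ->] := to_coset_surj C; rewrite !to_cosetM mulgA.
Qed.

Fact coset_mul1 : left_id coset_one coset_mul.
Proof.
by move=> A; have [x ->] := to_coset_surj A; rewrite to_cosetM mul1g.
Qed.

Fact coset_mulr1 : right_id coset_one coset_mul.
Proof.
by move=> A; have [x ->] := to_coset_surj A; rewrite to_cosetM mulg1.
Qed.

Fact coset_mulV : left_inverse coset_one coset_inv coset_mul.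
Proof.
by move=> A; have [x ->] := to_coset_surj A; rewrite to_cosetV to_cosetM mulVg.
Qed.

Fact coset_mulrV : right_inverse coset_one coset_inv coset_mul.
Proof.
by move=> A; have [x ->] := to_coset_surj A; rewrite to_cosetV to_cosetM mulgV.
Qed.

HB.instance Definition _ := isGroup.Build (left_coset N)
  coset_mulA coset_mul1 coset_mulr1 coset_mulV coset_mulrV.

End QuotientGroup.

Definition quotient_group (G : groupType) (N : normal_subgroup G) : groupType :=
  left_coset N.

Definition Zgroup : groupType := Algebra.to_multiplicative int.

(* The semidirect product of Z by {1, -1}: the pair (a, s) stands for the
   isometry i |-> a + (-1)^s i of Z. *)
Definition dihedral_inf : Type := (int * bool)%type.

HB.instance Definition _ := Choice.on dihedral_inf.

Section DihedralGroup.
Implicit Types x y z : dihedral_inf.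

Definition dih_one : dihedral_inf := (0%R, false).
Definition dih_mul x y : dihedral_inf :=
  ((x.1 + (-1) ^+ x.2 * y.1)%R, x.2 (+) y.2).
Definition dih_inv x : dihedral_inf := ((- ((-1) ^+ x.2 * x.1))%R, x.2).

Fact dih_mulA : associative dih_mul.
Proof.
case=> [a s] [b t] [c u]; rewrite /dih_mul /=; congr (_, _).
  by rewrite signr_addb mulrDr addrA mulrA.
exact: addbA.
Qed.

Fact dih_mul1 : left_id dih_one dih_mul.
Proof. by case=> a s; rewrite /dih_mul /= expr0 mul1r add0r. Qed.

Fact dih_mulr1 : right_id dih_one dih_mul.
Proof. by case=> a s; rewrite /dih_mul /= mulr0 addr0 addbF. Qed.

Fact dih_mulV : left_inverse dih_one dih_inv dih_mul.
Proof. by case=> a s; rewrite /dih_mul /= addNr addbb. Qed.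

Fact dih_mulrV : right_inverse dih_one dih_inv dih_mul.
Proof.
by case=> a s; rewrite /dih_mul /= mulrN mulrA -signr_addb addbb mul1r subrr.
Qed.

HB.instance Definition _ := isGroup.Build dihedral_inf
  dih_mulA dih_mul1 dih_mulr1 dih_mulV dih_mulrV.

End DihedralGroup.

Section Actions.
Variable Γ : digraph.
Implicit Types (H N : set (aut Γ)) (X : set Γ).

Definition transitive_on H X : Prop :=
  forall u v, X u -> X v -> exists2 g, H g & g u = v.

Definition trivial_on H X : Prop := forall g u, H g -> X u -> g u = u.

Definition vertex_transitive : Prop := transitive_on [set: aut Γ] [set: Γ].

Definition arc_transitive : Prop :=
  forall u v u' v' : Γ, is_arc u v -> is_arc u' v' ->
  exists g : aut Γ, g u = u' /\ g v = v'.

Definition two_arc_transitive : Prop :=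
  forall u v w u' v' w' : Γ,
  is_arc u v -> is_arc v w -> is_arc u' v' -> is_arc v' w' ->
  exists g : aut Γ, [/\ g u = u', g v = v' & g w = w'].

Definition stabilizer (v : Γ) : set (aut Γ) := [set g | g v = v].

Definition quasi_primitive_on H X : Prop :=
  transitive_on H X /\
  forall M, is_normal_in M H -> trivial_on M X \/ transitive_on M X.

Definition locally_quasi_primitive : Prop :=
  vertex_transitive /\
  forall v, quasi_primitive_on (stabilizer v) (in_nbrs v) /\
            quasi_primitive_on (stabilizer v) (out_nbrs v).

Definition aut_orbit N (v : Γ) : set Γ := [set g v | g in N].

Definition finite_orbits N : Prop := forall v, finite_set (aut_orbit N v).

Record orbit_type N := Orbit
  { orbit_set : set Γ; orbit_typeP : `[< exists v, orbit_set = aut_orbit N v >] }.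

HB.instance Definition _ N := [isSub for @orbit_set N].
HB.instance Definition _ N := [Choice of orbit_type N by <:].

Definition quotient_digraph N : digraph :=
  @Digraph (orbit_type N) (fun A B =>
    `[< exists v w, [/\ orbit_set A v, orbit_set B w & is_arc v w] >]).

Fact orbit_subproof N v : `[< exists w, aut_orbit N v = aut_orbit N w >].
Proof. by apply/asboolP; exists v. Qed.

Definition quotient_map N (v : Γ) : quotient_digraph N :=
  Orbit (orbit_subproof N v).

Definition isom_after_quotient N (Δ : digraph) (f : Γ -> Δ) : Prop :=
  exists2 h : quotient_digraph N -> Δ, digraph_isom h
    & forall v, f v = h (quotient_map N v).

End Actions.

Section Cases.
Variables (Γ : digraph) (N : normal_subgroup (aut Γ)).

Definition dihedral_case : Prop :=
  digraph_isomorphic (quotient_digraph N) Zdigraph /\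
  group_isomorphic (quotient_group N) dihedral_inf.

Definition cyclic_case : Prop :=
  digraph_isomorphic (quotient_digraph N) Zvec /\
  group_isomorphic (quotient_group N) Zgroup.

End Cases.

(* Main.v *)
(** Every finite separator S of the two ends splits the graph into two sides
    D false and D true.  Let h be 1, -1 and 0 on D false, D true and S, and let
    eps g be the sign telling whether the automorphism g swaps the ends.  A set
    with finite boundary that contains no ray is finite (Koenig's lemma if the
    valencies are finite, otherwise already nonempty sets contain rays), so
    h - eps g * (h o g^-1) has finite support, and summing it gives a cocycle
    tau: the map g |-> (tau g, eps g) is a homomorphism to the infinite dihedral
    group.  If g fixes the ends and moves a connected S off itself then
    tau g <> 0, so elements of the kernel N move S to a set meeting S, and
    Neumann's covering lemma makes the orbits of N finite.  Vertex stabilisers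
    contain no translation since the graph is infinite, and arc-transitivity
    together with connectedness forces the image to act on the integers with
    arcs joining consecutive integers.

    For the listed properties, the fibres of phi are blocks.  In the dihedral
    case some element fixes v and exchanges its two adjacent layers, and double
    counting the arcs between two layers of equal size shows that all four
    numbers of neighbours of v are the same.  An automorphism fixing two
    consecutive layers fixes all of them; if such elements of each vertex
    stabiliser fix the neighbours of that vertex, they are trivial by
    connectedness, so that stabilisers have order at most 2. *)

Require Import Defs.
From HB Require Import structures.
From mathcomp Require Import all_boot all_order all_algebra finmap.
From mathcomp Require Import boolp classical_sets functions cardinality fsbigop.
From mathcomp Require Import zify ring.

Set Implicit Arguments.
Unset Strict Implicit.
Unset Printing Implicit Defensive.

Import Order.TTheory GRing.Theory Num.Theory.

Local Open Scope classical_set_scope.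
Local Open Scope ring_scope.
Local Open Scope card_scope.


(** * Cuts and ends *)

Section Cuts.
Variable Γ : digraph.
Implicit Types (u v w : Γ) (r s t : nat -> Γ) (S T : seq Γ) (A B : set Γ).

Lemma adjC u v : adj u v = adj v u.
Proof. by rewrite /adj /= orbC. Qed.

(** All neighbours of [A] outside [A] lie in the list [S], so [A] has finite boundary; [S] may meet
    [A]. *)
Definition closed_off S A := forall u v, A u -> adj u v -> A v \/ v \in S.

Definition outside S A : set Γ := [set v | ~ A v /\ v \notin S].

Definition eventually r A := exists n, forall m, (n <= m)%N -> A (r m).

(** Ends seen through finite cuts. The definition is one-sided; on rays the relation is symmetric,
    because a tail of a ray lies on one side of each cut. *)
Definition same_end r s :=
  forall S A, closed_off S A -> eventually r A -> eventually s A.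

Lemma closed_off_outside S A : closed_off S A -> closed_off S (outside S A).
Proof.
move=> cA u v [nAu uS] uv; case: (boolP (v \in S)); first by right.
left; split=> // Av; case: (cA v u Av); rewrite 1?adjC // => uS'.
by rewrite uS' in uS.
Qed.

Lemma closed_offI S T A B : closed_off S A -> closed_off T B ->
  closed_off (S ++ T) (A `&` B).
Proof.
move=> cA cB u v [Au Bu] uv; rewrite mem_cat.
case: (cA u v Au uv) => [Av|->]; last by right.
by case: (cB u v Bu uv) => [Bv|->]; [left | right; rewrite orbT].
Qed.

Lemma ray_avoids r S : is_ray r -> exists n, forall m, (n <= m)%N -> r m \notin S.
Proof.
move=> [inj_r _]; elim: S => [|x S [n nS]]; first by exists 0%N.
have [[k kx]|nx] := pselect (exists k, r k = x).
  exists (maxn k.+1 n) => m; rewrite geq_max => /andP[km nm].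
  by rewrite inE negb_or nS // andbT -kx (inj_eq inj_r) neq_ltn km orbT.
exists n => m nm; rewrite inE negb_or nS // andbT.
by apply/eqP => mx; apply: nx; exists m.
Qed.

Lemma ray_avoids_closed r S A n : is_ray r -> closed_off S A ->
  (forall m, (n <= m)%N -> r m \notin S) -> A (r n) ->
  forall m, (n <= m)%N -> A (r m).
Proof.
move=> [_ adj_r] cA nS An m /subnKC <-.
elim: (m - n)%N => [|k IH]; first by rewrite addn0.
rewrite addnS; case: (cA _ _ IH (adj_r _)) => // kS.
by move: (nS (n + k).+1); rewrite kS -addnS leq_addr => /(_ isT).
Qed.

Lemma eventually_dichotomy r S A : is_ray r -> closed_off S A ->
  eventually r A \/ eventually r (outside S A).
Proof.
move=> rr cA; have [n nS] := ray_avoids S rr.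
have [[m nm Am]|nA] := pselect (exists2 m, (n <= m)%N & A (r m)).
  left; exists m; apply: (ray_avoids_closed rr cA) => // k mk.
  by apply: nS; apply: leq_trans mk.
right; exists n => m nm; split; last exact: nS.
by move=> Am; apply: nA; exists m.
Qed.

Lemma eventually_meet r A B : eventually r A -> eventually r B ->
  (A `&` B) !=set0.
Proof.
move=> [n An] [m Bm]; exists (r (maxn n m)).
by split; [apply: An; rewrite leq_maxl | apply: Bm; rewrite leq_maxr].
Qed.

Lemma eventually_sub r A B : A `<=` B -> eventually r A -> eventually r B.
Proof. by move=> AB [n nA]; exists n => m /nA/AB. Qed.

Lemma same_end_trans r s t : same_end r s -> same_end s t -> same_end r t.
Proof. by move=> rs st S A cA /(rs _ _ cA)/(st _ _ cA). Qed.

Lemma same_end_sym r s : is_ray r -> is_ray s -> same_end r s -> same_end s r.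
Proof.
move=> rr rs ers S A cA As.
have [//|Br] := eventually_dichotomy rr cA.
have Bs := ers _ _ (closed_off_outside cA) Br.
by have [v [Av []]] := eventually_meet As Bs.
Qed.

Definition linked r s S := exists x (p : seq Γ),
  [/\ path (@adj Γ) x p, uniq (x :: p), range r x, range s (last x p) &
      all (fun z => z \notin S) (x :: p)].

(** The disjoint paths are chosen greedily: [T n] lists the vertices of the first [n] paths, and the
    next path is taken off [T n]. *)
Lemma linked_ray_equiv r s : (forall S, linked r s S) -> ray_equiv r s.
Proof.
move=> L; have /choice[F FP] : forall S, exists xp : Γ * seq Γ,
    [/\ path (@adj Γ) xp.1 xp.2, uniq (xp.1 :: xp.2), range r xp.1,
        range s (last xp.1 xp.2) & all (fun z => z \notin S) (xp.1 :: xp.2)].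
  by move=> S; have [x [p xp]] := L S; exists (x, p).
pose T := fix T n := if n is n'.+1
  then T n' ++ ((F (T n')).1 :: (F (T n')).2) else [::].
have subT m n : (m <= n)%N -> {subset T m <= T n}.
  move=> /subnKC <-; elim: (n - m)%N => [|k IH] z; first by rewrite addn0.
  by move=> /IH zT; rewrite addnS /= mem_cat zT.
have disj m n z : (m < n)%N -> z \in (F (T m)).1 :: (F (T m)).2 ->
    z \notin (F (T n)).1 :: (F (T n)).2.
  move=> mn zm; have zT : z \in T n.
    by apply: (subT _ _ mn); rewrite /= mem_cat zm orbT.
  have [_ _ _ _ /allP avoid] := FP (T n).
  by apply/negP => /avoid; rewrite zT.
exists (fun n => (F (T n)).1), (fun n => (F (T n)).2); split.
  by move=> n; have [] := FP (T n).
move=> m n; rewrite neq_ltn => /orP[mn|nm] z zm; first exact: disj mn zm.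
by apply/negP => zn; have := disj _ _ _ nm zn; rewrite zm.
Qed.

(** Pairwise disjoint paths that all met [S] would inject the natural numbers into [S]. *)
Lemma ray_equiv_linked r s S : ray_equiv r s -> linked r s S.
Proof.
move=> [x [p [xp disj]]].
suff [n nS] : exists n, all (fun z => z \notin S) (x n :: p n).
  by have [? ? ? ?] := xp n; exists (x n), (p n).
apply: contrapT => /forallNP meetS.
have /choice[z zP] : forall n, exists z, z \in x n :: p n /\ z \in S.
  move=> n; have /negP := meetS n.
  by rewrite -has_predC => /hasP[z zn /negPn zS]; exists z.
have inj_z : injective z.
  move=> m n mn; apply/eqP/negPn/negP => neq.
  have /negP[] := disj _ _ neq (z m) (zP m).1.
  by rewrite mn; apply: (zP n).1.
have subS : {subset map z (iota 0 (size S).+1) <= S}.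
  by move=> _ /mapP[n _ ->]; exact: (zP n).2.
have := uniq_leq_size _ subS; rewrite map_inj_uniq // iota_uniq size_map.
by rewrite size_iota ltnn => /(_ isT).
Qed.

Lemma closed_off_path S A x p : closed_off S A -> path (@adj Γ) x p ->
  all (fun z => z \notin S) p -> A x -> A (last x p).
Proof.
move=> cA; elim: p x => //= y p IH x /andP[xy yp] /andP[yS pS] Ax.
by apply: IH => //; case: (cA _ _ Ax xy) => // yS'; rewrite yS' in yS.
Qed.

Lemma ray_equivP r s : is_ray r -> is_ray s -> ray_equiv r s <-> same_end r s.
Proof.
move=> rr rs; split=> [ers S A cA rA|ers]; last first.
  apply: linked_ray_equiv => S; apply: contrapT => nlink.
  (* The vertices reached from [r] off [S] form a set closed off by [S]. It contains a tail of [r],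
     hence one of [s], which gives the missing path. *)
  pose A : set Γ := [set v | exists x p, [/\ range r x, path (@adj Γ) x p,
    last x p = v & all (fun z => z \notin S) (x :: p)]].
  have cA : closed_off S A.
    move=> u v [x [p [rx xp <- xS]]] uv.
    case: (boolP (v \in S)) => [|vS]; [by right | left].
    exists x, (rcons p v); split; rewrite ?last_rcons //.
      by rewrite rcons_path xp.
    by rewrite -rcons_cons all_rcons vS.
  have [n nS] := ray_avoids S rr.
  have [|m mA] := ers _ _ cA.
    exists n => m nm; exists (r m), [::]; split=> //=; first by exists m.
    by rewrite nS.
  have [x [p [rx xp sx xS]]] := mA m (leqnn m).
  apply: nlink; case/shortenP: xp sx => p' xp' up' sub sx.
  exists x, p'; split=> //; first by exists m.
  by apply/allP => z; rewrite inE => /orP[/eqP->|/sub zp];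
    apply: (allP xS); rewrite inE ?eqxx // zp orbT.
have [//|[n nB]] := eventually_dichotomy rs cA.
have [k kA] := rA.
(* Off [T] the path starts on the tail of [r] inside [A] and stops on the tail of [s] outside [A],
   so it would have to cross [S]. *)
pose T := S ++ map r (iota 0 k) ++ map s (iota 0 n).
have [x [p [xp _ [i _ ix] [j _ jx] xT]]] := ray_equiv_linked T ers.
have [xTh pT] := andP xT.
have Ax : A x.
  rewrite -ix; apply: kA; rewrite leqNgt; apply/negP => ik.
  by move: xTh; rewrite !mem_cat -ix map_f ?orbT // mem_iota.
have pS : all (fun z => z \notin S) p.
  by apply: sub_all pT => z; rewrite !mem_cat negb_or => /andP[].
have Ap := closed_off_path cA xp pS Ax.
have : last x p \notin T by apply: (allP xT); apply: mem_last.
rewrite -jx; have [nj|jn] := leqP n j.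
  by have [] := nB _ nj; rewrite jx.
by rewrite !mem_cat map_f ?orbT // mem_iota.
Qed.

Lemma two_ended_rays : two_ended Γ -> exists r1 r2, [/\ is_ray r1, is_ray r2,
  ~ same_end r1 r2 & forall t, is_ray t -> same_end r1 t \/ same_end r2 t].
Proof.
move=> [_ /card_set_bijP[f [fE f_inj f_surj]]].
have [e1 [r1 rr1 e1E] fe1] := f_surj 0%N isT.
have [e2 [r2 rr2 e2E] fe2] := f_surj 1%N isT.
exists r1, r2; split=> //.
  move=> e12; suff e21 : e1 = e2 by move: fe1; rewrite e21 fe2.
  rewrite -e1E -e2E; apply/seteqP; split=> s [rs ers]; split=> //.
    apply/ray_equivP => //; apply: same_end_trans (same_end_sym rr1 rr2 e12) _.
    exact/ray_equivP.
  by apply/ray_equivP => //; apply: same_end_trans e12 _; apply/ray_equivP.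
move=> t rt; pose e := [set s | is_ray s /\ ray_equiv t s].
have et : e t by split=> //; apply/ray_equivP.
have eE : ends e by exists t.
have := fE e eE; rewrite /= => fe.
have inE1 : ends e1 by exists r1.
have inE2 : ends e2 by exists r2.
have [f0|f1] : f e = 0%N \/ f e = 1%N by case: (f e) fe => [|[]]; auto.
  have ee : e = e1 by apply: f_inj; rewrite ?inE ?f0 ?fe1.
  by left; apply/ray_equivP => //; move: et; rewrite ee -e1E => -[].
have ee : e = e2 by apply: f_inj; rewrite ?inE ?f1 ?fe2.
by right; apply/ray_equivP => //; move: et; rewrite ee -e2E => -[].
Qed.

End Cuts.

(** * Rays in sets with finite boundary *)

Section Rays.
Variable Γ : digraph.
Implicit Types (x y u v w : Γ) (r s t : nat -> Γ) (S T F Y : seq Γ) (A B C :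
  set Γ).

Lemma aut_arc (g : aut Γ) u v : is_arc (g u) (g v) = is_arc u v.
Proof. by have /asboolP[_ ->] := autP g. Qed.

Lemma aut_adj (g : aut Γ) u v : adj (g u) (g v) = adj u v.
Proof. by rewrite /adj /= !aut_arc. Qed.

(** [P F x] reads: the walk has used up [F], stands at [x] and can be continued. Used vertices are
    never revisited, so iteration gives a ray. *)
Lemma greedy_ray (P : seq Γ -> Γ -> Prop) :
    (forall F x, P F x -> x \notin F /\ exists2 y, adj x y & P (x :: F) y) ->
  forall F x, P F x -> exists2 t, is_ray t & forall n, exists F', P F' (t n).
Proof.
move=> step F x PFx.
have /choice[next nextP] : forall s : seq Γ * Γ, exists y,
    P s.1 s.2 -> adj s.2 y /\ P (s.2 :: s.1) y.
  move=> [F' x']; have [/step[_ [y xy Py]]|nP] := pselect (P F' x').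
    by exists y.
  by exists x' => /nP.
pose st n := iter n (fun q => (q.2 :: q.1, next q)) (F, x).
have Pst n : P (st n).1 (st n).2.
  by elim: n => // n IH; have [] := nextP _ IH.
have mem_st m n : (m < n)%N -> (st m).2 \in (st n).1.
  elim: n => // n IH; rewrite ltnS leq_eqVlt inE => /orP[/eqP->|/IH ->].
    by rewrite eqxx.
  by rewrite orbT.
exists (fun n => (st n).2); last by move=> n; exists (st n).1.
split=> [m n mn|n]; last by have [] := nextP _ (Pst n).
apply/eqP/negPn/negP; rewrite neq_ltn => /orP[|] /mem_st.
  by rewrite mn; apply/negP; have [] := step _ _ (Pst n).
by rewrite -mn; apply/negP; have [] := step _ _ (Pst m).
Qed.

Definition reach F x : set Γ := [set v | exists p,
  [/\ path (@adj Γ) x p, last x p = v & all (fun z => z \notin F) (x :: p)]].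

(** A path to [v] that meets [x] is cut after its last visit to [x]; the rest starts at a neighbour
    of [x]. *)
Lemma reach_cons F x y v : reach F y v -> v <> x ->
  reach (x :: F) y v \/ exists2 z, adj x z & reach (x :: F) z v.
Proof.
move=> [p [yp yv yF]] vx; elim: p y yp yv yF => [|z p IH] y /=.
  move=> _ yv /andP[yF _]; left; exists [::]; split=> //=.
  by rewrite andbT inE negb_or yF andbT yv; apply/eqP.
move=> /andP[yz zp] zv /andP[yF pF].
have [[q [zq qv qF]]|] := IH z zp zv pF; last by right.
have [yx|/eqP yx] := eqVneq y x; first by right; exists z; [rewrite -yx|exists q].
left; exists (z :: q); split; rewrite //= ?yz //.
by rewrite inE negb_or yF andbT; apply/andP; split=> //; apply/eqP.
Qed.

Lemma infinite_cover S Y C (R : Γ -> set Γ) : infinite_set C ->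
    (forall v, C v -> v \notin S -> exists2 y, y \in Y & R y v) ->
  exists2 y, y \in Y & infinite_set (C `&` R y).
Proof.
move=> infC cov; apply: contrapT => /forall2NP fin; apply: infC.
apply: (@sub_finite_set Γ _
  ([set` S] `|` \bigcup_(y in [set` Y]) (C `&` R y))).
  move=> v Cv; case: (boolP (v \in S)) => [|vS]; first by left.
  by right; have [y yY Ryv] := cov _ Cv vS; exists y.
rewrite finite_setU; split; first exact: finite_seq.
apply: bigcup_finite; first exact: finite_seq.
by move=> y yY; have [//|/contrapT] := fin y.
Qed.

Definition nbrs x : set Γ := [set y | adj x y].

(** Deleting a finite set leaves finitely many components, represented by [Y]. On deleting one more
    vertex [x], its neighbours suffice as new representatives. *)
Lemma reach_cover : connected Γ -> (forall x, finite_set (nbrs x)) ->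
  forall (b : Γ) F, exists Y, forall v, v \notin F -> exists2 y, y \in Y &
    reach F y v.
Proof.
move=> conn fin b; elim=> [|x F [Y YP]].
  exists [:: b] => v _; exists b; first exact: mem_head.
  by have [p bp bv] := conn b v; exists p; split=> //; apply/allP.
have /finite_seqP[N NE] := fin x.
exists (Y ++ N) => v; rewrite inE negb_or => /andP[/eqP vx vF].
have [y yY yv] := YP v vF.
have [?|[z xz zv]] := reach_cons yv vx; first by exists y; rewrite // mem_cat yY.
exists z => //; have : nbrs x z by [].
by rewrite NE mem_cat /= => ->; rewrite orbT.
Qed.

Lemma reach_closed_off S C F x v : closed_off S C -> {subset S <= F} ->
  reach F x v -> C v -> C x.
Proof.
move=> cC SF [p [xp <- xF]] Cv; apply: contrapT => nCx.
have pS : all (fun z => z \notin S) (x :: p).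
  by apply: sub_all xF => z; apply: contra => /SF.
have [xS pS'] := andP pS.
by have [] := closed_off_path (closed_off_outside cC) xp pS' (conj nCx xS).
Qed.

(** The invariant is that infinitely many vertices of [C] can be reached from the head of the walk
    off the used vertices. Such a head lies in [C], because [S] is among the used vertices. *)
Lemma koenig S C : connected Γ -> (forall x, finite_set (nbrs x)) ->
  closed_off S C -> infinite_set C -> exists2 t, is_ray t & forall n, C (t n).
Proof.
move=> conn fin cC infC.
have [b _] := infinite_setN0 infC.
have [Y YP] := reach_cover conn fin b S.
pose P F x := {subset S <= F} /\ infinite_set (C `&` reach F x).
have step F x : P F x -> x \notin F /\ exists2 y, adj x y & P (x :: F) y.
  move=> [SF inf]; split.
    by have [v [_ [p [_ _ /andP[]]]]] := infinite_setN0 inf.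
  have /finite_seqP[N NE] := fin x.
  have [|y yN infy] := @infinite_cover [:: x] N _ (reach (x :: F)) inf.
    move=> v [Cv xv]; rewrite inE => /eqP vx.
    have [[p [_ _]]|[z xz zv]] := reach_cons xv vx.
      by rewrite /= inE eqxx.
    by exists z => //; have : nbrs x z by []; rewrite NE.
  exists y; first by have : [set` N] y by []; rewrite -NE.
  split; first by move=> z /SF zF; rewrite inE zF orbT.
  by apply: sub_infinite_set infy => v [[]].
have [|y _ infy] := @infinite_cover S Y C (reach S) infC.
  by move=> v _ /YP.
have [|t rt Pt] := greedy_ray step (F := S) (x := y); first by split.
exists t => // n; have [F [SF inf]] := Pt n.
have [v [Cv xv]] := infinite_setN0 inf.
exact: reach_closed_off cC SF xv Cv.
Qed.

Lemma ray_of_infinite_degrees S C : (forall x, infinite_set (nbrs x)) ->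
  closed_off S C -> infinite_set C -> exists2 t, is_ray t & forall n, C (t n).
Proof.
move=> inf cC infC.
have new x F D : infinite_set D -> exists2 y : Γ, D y & y \notin F.
  move=> infD; apply: contrapT => /forall2NP sub; apply: infD.
  apply: (@sub_finite_set Γ _ [set` F]); last exact: finite_seq.
  by move=> y Dy; have [//|/negP/negPn] := sub y.
have [b _] := infinite_setN0 infC; have [x Cx xS] := new b S C infC.
pose P F x := [/\ {subset S <= F}, x \notin F & C x].
have step F y : P F y -> y \notin F /\ exists2 z, adj y z & P (y :: F) z.
  move=> [SF yF Cy]; split=> //; have [z yz zF] := new b (y :: F) _ (inf y).
  exists z => //; split=> //.
    by move=> u /SF uF; rewrite inE uF orbT.
  case: (cC _ _ Cy yz) => // /SF zF'.
  by rewrite inE zF' orbT in zF.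
have [|t rt Pt] := greedy_ray step (F := S) (x := x); first by split.
by exists t => // n; have [F []] := Pt n.
Qed.

(** By vertex-transitivity the undirected valencies are all finite or all infinite, and each case
    has its own construction of a ray. *)
Lemma vertex_transitive_ray S C : connected Γ -> vertex_transitive Γ ->
  closed_off S C -> infinite_set C -> exists2 t, is_ray t & forall n, C (t n).
Proof.
move=> conn vt cC infC.
have [[x finx]|inf] := pselect (exists x, finite_set (nbrs x)); last first.
  by apply: ray_of_infinite_degrees cC infC => x fx; apply: inf; exists x.
apply: koenig cC infC => // y.
have [g _ <-] := vt x y I I.
apply: (@sub_finite_set Γ _ (g @` nbrs x)); last exact: finite_image.
move=> z gxz; exists (g^-1%g z); last exact: (aut_inv_funK g).
by rewrite /nbrs /= -(aut_adj g); have -> := aut_inv_funK g z.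
Qed.

End Rays.

(** * The translation cocycle *)

Lemma fsum_add (I : choiceType) (F G : I -> int) :
  finite_set [set i | F i != 0] -> finite_set [set i | G i != 0] ->
  \sum_(i \in [set: I]) (F i + G i) =
  \sum_(i \in [set: I]) F i + \sum_(i \in [set: I]) G i.
Proof.
move=> finF finG.
have finU : finite_set ([set i | F i != 0] `|` [set i | G i != 0]).
  by rewrite finite_setU.
pose X := fset_set ([set i | F i != 0] `|` [set i | G i != 0]).
have XP i : i \notin X -> F i = 0 /\ G i = 0.
  rewrite in_fset_set // notin_setE /= => /not_orP[/negP/negPn/eqP ? /negP].
  by move=> /negPn/eqP.
rewrite !(@fsbigTE _ _ _ _ X) ?big_split //.
- by move=> i /XP[].
- by move=> i /XP[].
by move=> i /XP[-> ->].
Qed.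

(** * Connected finite sets, translates and the two sides of a cut *)

Section LinkedSets.
Variable Γ : digraph.
Implicit Types (u v w : Γ) (S T : seq Γ) (X : set Γ).

Definition closed_within S X :=
  forall u v, u \in S -> v \in S -> adj u v -> X u -> X v.

(* [S] spans a connected subgraph. *)
Definition linked_seq S :=
  forall X, closed_within S X -> forall u v, u \in S -> v \in S -> X u -> X v.

(** Join every vertex of [S] to [b] by a path; the union of the paths is connected. *)
Lemma linked_superset (b : Γ) S : connected Γ ->
  exists T, [/\ {subset S <= T}, b \in T & linked_seq T].
Proof.
move=> conn.
suff [T [ST bT XT]] : exists T, [/\ {subset S <= T}, b \in T &
    forall X, closed_within T X -> forall v, v \in T -> X v <-> X b].
  exists T; split=> // X cX u v uT vT.
  by move=> /(XT X cX u uT)/(XT X cX v vT).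
elim: S => [|s S [T [ST bT XT]]].
  exists [:: b]; split=> //; first by rewrite mem_head.
  by move=> X _ v; rewrite inE => /eqP ->.
have [p bp ps] := conn b s.
exists ((b :: p) ++ T); split.
- move=> v; rewrite inE => /orP[/eqP->|/ST vT]; rewrite mem_cat.
    by rewrite -ps mem_last.
  by rewrite vT orbT.
- by rewrite mem_cat bT orbT.
move=> X cX v; rewrite mem_cat => /orP[|vT]; last first.
  by apply: XT vT => u w uT wT; apply: cX; rewrite mem_cat (uT, wT) orbT.
have {cX XT} : closed_within (b :: p) X.
  by move=> u w up wp; apply: cX; rewrite mem_cat (up, wp).
elim: p b bp {bT ps} => [|z p IH] b; first by move=> _ _; rewrite inE => /eqP->.
move=> /= /andP[bz zp] cX; rewrite inE => /orP[/eqP->//|vzp].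
have zbp : z \in [:: b, z & p] by rewrite !inE eqxx orbT.
apply: (iff_trans (IH z zp _ vzp)).
  by move=> u w up wp; apply: cX; rewrite inE (up, wp) orbT.
by split; apply: cX; rewrite ?mem_head // adjC.
Qed.

End LinkedSets.

Section Translates.
Variable Γ : digraph.
Implicit Types (g : aut Γ) (u v w : Γ) (r s t : nat -> Γ) (S T : seq Γ).
Implicit Types (A B X : set Γ).

Lemma autVK g : cancel g g^-1%g.
Proof. exact: aut_funK. Qed.

Lemma autKV g : cancel (g^-1%g : aut Γ) g.
Proof. exact: aut_inv_funK. Qed.

Lemma aut_inj g : injective g.
Proof. exact: can_inj (autVK g). Qed.

Definition translate g A : set Γ := [set v | A (g^-1%g v)].

Lemma autVK_comp g r : (g^-1)%g \o (g \o r) = r.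
Proof. by apply/funext => n; exact: (autVK g (r n)). Qed.

Lemma autKV_comp g r : g \o ((g^-1)%g \o r) = r.
Proof. by apply/funext => n; exact: (autKV g (r n)). Qed.

Lemma translateE g A v : translate g A (g v) = A v.
Proof. by rewrite /translate /mkset autVK. Qed.

Lemma translateVE g A v : translate g^-1%g A v = A (g v).
Proof. by rewrite /translate /mkset invgK. Qed.

Lemma closed_off_translate g S A :
  closed_off S A -> closed_off (map g S) (translate g A).
Proof.
move=> cA u v Agu uv; have [|?|vS] := cA _ (g^-1%g v) Agu.
- by rewrite aut_adj.
- by left.
by right; rewrite -(autKV g v) map_f.
Qed.

Lemma aut_ray g r : is_ray r -> is_ray (g \o r).
Proof.
move=> [inj_r adj_r]; split=> [|n]; first exact: inj_comp (@aut_inj g) inj_r.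
by rewrite /= aut_adj.
Qed.

Lemma eventually_translate g r A :
  eventually r A -> eventually (g \o r) (translate g A).
Proof. by move=> [n nA]; exists n => m /nA; rewrite /comp translateE. Qed.

Lemma same_end_aut g r s : same_end r s -> same_end (g \o r) (g \o s).
Proof.
move=> ers S A cA gA.
have /ers : eventually r (translate g^-1%g A).
  by have [n nA] := gA; exists n => m /nA; rewrite translateVE.
move=> /(_ (map g^-1%g S) (closed_off_translate cA)) [n nA].
by exists n => m /nA; rewrite translateVE.
Qed.

End Translates.

Arguments same_end_aut {Γ} g {r s} _.

(* [E false] and [E true] represent the two ends, [D false] and [D true] are
   the two sides of the finite separator [S]. *)
Record end_cut (Γ : digraph) (E : bool -> nat -> Γ) (S : seq Γ)
    (D : bool -> set Γ) : Prop := EndCut {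
  cut_ray : forall b, is_ray (E b);
  cut_ends : forall t, is_ray t -> exists b, same_end (E b) t;
  cut_closed : forall b, closed_off S (D b);
  cut_eventually : forall b, eventually (E b) (D b);
  cut_cover : forall v, v \in S \/ exists b, D b v;
  cut_side : forall b v, D b v -> v \notin S;
  cut_disjoint : forall b c v, D b v -> D c v -> b = c;
  cut_linked : linked_seq S;
  cut_nonempty : exists s, s \in S }.

Arguments cut_closed {Γ E S D} _ b.

(** A finite cut that distinguishes the two rays is enlarged to a connected list [S], which is then
    removed from the side [A0]. Including [r1 0] makes [S] nonempty. *)
Lemma two_ended_cut (Γ : digraph) : two_ended Γ ->
  exists E S D, @end_cut Γ E S D.
Proof.
move=> te; have [r1 [r2 [rr1 rr2 ne12 all_ends]]] := two_ended_rays te.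
have [conn _] := te.
have [S0 [A0 [cA0 ev1 nev2]]] : exists S A,
    [/\ closed_off S A, eventually r1 A & ~ eventually r2 A].
  apply: contrapT => no_cut; apply: ne12 => S A cA ev1.
  by apply: contrapT => nev2; apply: no_cut; exists S, A.
have [S [S0S bS linkS]] := linked_superset (r1 0%N) S0 conn.
pose A := [set v | A0 v /\ v \notin S].
have cA : closed_off S A.
  move=> u v [Au uS] uv; case: (boolP (v \in S)) => vS; [by right | left].
  by split=> //; case: (cA0 _ _ Au uv) => // /S0S; rewrite (negPf vS).
exists (fun b => if b then r2 else r1), S,
  (fun b => if b then outside S A else A); split.
- by case.
- by move=> t /all_ends[]; [exists false | exists true].
- by case=> //; apply: closed_off_outside.
- case; last first.
    have [n nS] := ray_avoids S rr1; have [m mA] := ev1.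
    exists (maxn n m) => k; rewrite geq_max => /andP[nk mk].
    by split; [apply: mA | apply: nS].
  have [|//] := eventually_dichotomy rr2 cA.
  by move/(@eventually_sub _ _ _ A0) => ev2; case: nev2; apply: ev2 => v [].
- move=> v; case: (boolP (v \in S)) => vS; [by left | right].
  have [Av|nAv] := pselect (A v); first by exists false.
  by exists true.
- by case=> v [].
- by case; case=> v //; [case=> nAv _ /nAv | move=> Av [/(_ Av)]].
- by [].
by exists (r1 0%N).
Qed.

Section Translation.
Variables (Γ : digraph) (E : bool -> nat -> Γ) (S : seq Γ) (D : bool -> set Γ).
Hypotheses (conn : connected Γ) (vt : vertex_transitive Γ).
Hypothesis cut : end_cut E S D.
Implicit Types (g h : aut Γ) (b c : bool) (u v w : Γ).

Lemma cut_end_inj b c : same_end (E b) (E c) -> b = c.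
Proof.
move=> /(_ S (D b) (cut_closed cut b) (cut_eventually cut b)) ev.
have [v [Dbv Dcv]] := eventually_meet ev (cut_eventually cut c).
exact (cut_disjoint cut Dbv Dcv).
Qed.

Lemma side_end b t : is_ray t -> eventually t (D b) -> same_end (E b) t.
Proof.
move=> rt ev; have [c ct] := cut_ends cut rt.
have evc := ct _ _ (cut_closed cut c) (cut_eventually cut c).
have [v [Dbv Dcv]] := eventually_meet ev evc.
by rewrite (cut_disjoint cut Dbv Dcv).
Qed.

Definition swaps g : bool := ~~ `[< same_end (E false) (g \o E false) >].

(** An automorphism permutes the two ends: if their images coincided, applying the inverse would
    identify the ends themselves. *)
Lemma end_swaps g b : same_end (E (swaps g (+) b)) (g \o E b).
Proof.
have [x xP] := cut_ends cut (aut_ray g (cut_ray cut false)).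
have [y yP] := cut_ends cut (aut_ray g (cut_ray cut true)).
have xy : x != y.
  apply/eqP => xy; rewrite -xy in yP.
  have gg : same_end (g \o E false) (g \o E true).
    apply: same_end_trans yP; apply: same_end_sym xP.
      exact: cut_ray cut _.
    exact/aut_ray/(cut_ray cut).
  have := same_end_aut (g^-1)%g gg.
  by rewrite !autVK_comp => /cut_end_inj.
have sx : swaps g = x.
  rewrite /swaps; case: x xP xy => xP _.
    apply/asboolPn => Pf; have /cut_end_inj // : same_end (E false) (E true).
    apply: same_end_trans Pf _; apply: same_end_sym xP;
      first exact: cut_ray cut _.
    exact/aut_ray/(cut_ray cut).
  by apply/negPn/asboolP.
by rewrite sx; case: b; [case: x y xy xP yP {sx} => [] [] | rewrite addbF].
Qed.

Lemma swapsM g h : swaps (g * h)%g = swaps g (+) swaps h.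
Proof.
have e1 := same_end_aut g (@end_swaps h false).
have e2 := same_end_trans (@end_swaps g _) e1.
apply: cut_end_inj; apply: same_end_trans (same_end_sym _ _ _).
- by have := @end_swaps (g * h)%g false; rewrite addbF; apply.
- exact: cut_ray cut _.
- exact/aut_ray/(cut_ray cut).
by rewrite addbF in e2.
Qed.

(** The intersection has finite boundary, so if infinite it would contain a ray. This ray would
    belong both to end [b] and to the image under [g] of end [c], which differ. *)
Lemma finite_side_meet g b c : b != swaps g (+) c ->
  finite_set (D b `&` translate g (D c)).
Proof.
move=> bc; apply: contrapT => inf.
have cI := closed_offI (cut_closed cut b)
  (closed_off_translate (g := g) (cut_closed cut c)).
have [t rt tI] := vertex_transitive_ray conn vt cI inf.
have tb : same_end (E b) t.
  by apply: side_end => //; exists 0%N => n _; have [] := tI n.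
have tc : same_end (E c) (g^-1%g \o t).
  apply: side_end; first exact: aut_ray.
  by exists 0%N => n _; have [] := tI n.
have := same_end_aut g tc.
rewrite autKV_comp => /(same_end_trans (@end_swaps g c)) => tc'.
move/eqP: bc; apply; apply: cut_end_inj.
apply: same_end_trans tb _; apply: same_end_sym tc' => //.
exact: cut_ray cut _.
Qed.

Definition height v : int :=
  if `[< D false v >] then 1 else if `[< D true v >] then -1 else 0.

Lemma height_side b v : D b v -> height v = (-1) ^+ b.
Proof.
rewrite /height; case: b => Dv.
  by case: asboolP => [/(cut_disjoint cut Dv)//|_]; rewrite asboolT.
by rewrite asboolT.
Qed.

Lemma height_cut v : v \in S -> height v = 0.
Proof.
move=> vS; rewrite /height.
by case: asboolP => [/(cut_side cut)/negP//|_];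
  case: asboolP => [/(cut_side cut)/negP//|_].
Qed.

Definition height_defect g v : int :=
  height v - (-1) ^+ swaps g * height (g^-1%g v).

Lemma finite_height_defect g : finite_set [set v | height_defect g v != 0].
Proof.
(* Off [S] and its translate the two terms of the defect cancel unless the sides of [v] and of its
   preimage belong to ends that [g] does not match. *)
pose bad := \bigcup_(b in [set: bool * bool])
  (if b.1 != swaps g (+) b.2 then D b.1 `&` translate g (D b.2) else set0).
apply: (@sub_finite_set _ _ ([set` S] `|` [set` map g S] `|` bad)).
  move=> v /=; rewrite /height_defect => dv.
  have [vS|[b Db]] := cut_cover cut v; first by left; left.
  have [vS|[c Dc]] := cut_cover cut (g^-1%g v).
    by left; right; rewrite /= -(autKV g v) map_f.
  right; exists (b, c) => //=; case: ifP => // /negbFE/eqP bc.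
  move: dv; rewrite (height_side Db) (height_side Dc) bc signr_addb.
  by rewrite subrr eqxx.
rewrite !finite_setU; split; first by split; apply: finite_seq.
apply: bigcup_finite => // -[b c] _ /=; case: ifP => // bc.
exact: finite_side_meet.
Qed.

Definition shift g : int := \sum_(v \in [set: Γ]) height_defect g v.

(** The defect of [g * h] at [v] is that of [g] at [v] plus the sign of [g] times that of [h] at
    [g^-1 v]; the second term is summed after reindexing. *)
Lemma shiftM g h : shift (g * h)%g = shift g + (-1) ^+ swaps g * shift h.
Proof.
rewrite /shift mulr_fsumr.
rewrite (@reindex_fsbigT _ _ _ _ _ (g^-1%g : Γ -> Γ) (fun v => _ * _));
  last first.
  by exists g; [apply: autKV | apply: autVK].
rewrite -fsum_add; last 2 first.
- exact: finite_height_defect.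
- apply: (@sub_finite_set _ _ (g @` [set v | height_defect h v != 0])).
    move=> v /= dv; exists (g^-1%g v); last exact: autKV.
    by apply: contraNneq dv => /= ->; rewrite mulr0.
  exact/finite_image/finite_height_defect.
apply: eq_fsbigr => v _; rewrite /height_defect swapsM signr_addb invgM.
rewrite [(h^-1 * g^-1)%g _]/=.
ring.
Qed.

End Translation.

(** * Kernel orbits are finite *)

Lemma connected_closed (Γ : digraph) (X : set Γ) (x y : Γ) : connected Γ ->
  (forall u v, X u -> adj u v -> X v) -> X x -> X y.
Proof.
move=> conn cX Xx; have [p xp <-] := conn x y.
have cX' : closed_off [::] X by move=> u v Xu uv; left; apply: cX uv.
by apply: (closed_off_path cX' xp) => //; apply/allP.
Qed.

Section Displacement.
Variables (Γ : digraph) (E : bool -> nat -> Γ) (S : seq Γ) (D : bool -> set Γ).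
Hypotheses (conn : connected Γ) (vt : vertex_transitive Γ).
Hypothesis cut : end_cut E S D.
Implicit Types (g h : aut Γ) (b c : bool) (u v w : Γ).

(** The translate [g S] is connected and misses [S], so it cannot change sides. *)
Lemma displaced_side g : (forall s, s \in S -> g s \notin S) ->
  exists b, forall s, s \in S -> D b (g s).
Proof.
move=> gS; have [s0 s0S] := cut_nonempty cut.
have [gs0|[b Db]] := cut_cover cut (g s0);
  first by rewrite (negPf (gS _ s0S)) in gs0.
exists b => s sS; have := @cut_linked _ _ _ _ cut (fun v => D b (g v)).
apply; [|exact: s0S|exact: sS|exact: Db].
move=> u v uS vS uv Du; have [|//|] := cut_closed cut b _ (g v) Du.
  by rewrite aut_adj.
by rewrite (negPf (gS _ vS)).
Qed.

(** The boundary of this intersection could only meet [S] or [g S]. A neighbour in [S] is excluded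
    since [g^-1 S] lies in side [c], one in [g S] since [g S] lies in side [b]. A nonempty
    intersection would thus be the whole graph, including [S]. *)
Lemma translate_meet_empty g b c :
  (forall s, s \in S -> D b (g s)) -> (forall s, s \in S -> D c (g^-1%g s)) ->
  forall x, D (~~ b) x -> D (~~ c) (g^-1%g x) -> False.
Proof.
move=> Db Dc x Dx Dgx; have [s sS] := cut_nonempty cut.
pose X : set Γ := fun u => D (~~ b) u /\ D (~~ c) (g^-1%g u).
suff [/(cut_side cut)] : X s by rewrite sS.
apply: (@connected_closed _ X x) => //.
  move=> u v [Du Dgu] uv; split.
    have [//|vS] := cut_closed cut _ _ _ Du uv.
    have : adj (g^-1%g u) (g^-1%g v) by rewrite aut_adj.
    move=> /(cut_closed cut _ _ _ Dgu)[Dgv|].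
      by have := cut_disjoint cut Dgv (Dc _ vS); case: (c).
    by move/(cut_side cut): (Dc _ vS) => /negPf->.
  have : adj (g^-1%g u) (g^-1%g v) by rewrite aut_adj.
  move=> /(cut_closed cut _ _ _ Dgu)[//|gvS].
  have := Db _ gvS; rewrite autKV => Dbv.
  have [Dv|vS] := cut_closed cut _ _ _ Du uv.
    by have := cut_disjoint cut Dv Dbv; case: (b).
  by move/(cut_side cut): Dbv; rewrite vS.
Qed.

Lemma sgn_height_le1 b v : (-1) ^+ b * height D v <= 1.
Proof.
have [vS|[c Dc]] := cut_cover cut v; first by rewrite (height_cut cut vS) mulr0.
by rewrite (height_side cut Dc) -signr_addb; case: (b (+) c).
Qed.

Lemma shift_neq0 g : swaps E g = false -> (forall s, s \in S -> g s \notin S) ->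
  shift E D g != 0.
Proof.
move=> sg gS; have gVS s : s \in S -> g^-1%g s \notin S.
  by move=> sS; apply/negP => /gS; rewrite autKV sS.
have [b Db] := displaced_side gS; have [c Dc] := displaced_side gVS.
have empty := translate_meet_empty Db Dc.
(* As [g] fixes the ends, [D (~~ b)] and its translate both contain a tail of [E (~~ b)] and meet;
   for [c = b] this contradicts [empty]. *)
have bc : c = ~~ b.
  have ev := cut_eventually cut (~~ b).
  have e := same_end_sym (cut_ray cut _) (aut_ray g (cut_ray cut _))
    (@end_swaps _ _ _ _ cut g (~~ b)).
  rewrite sg /= in e.
  have evg := e _ _ (closed_off_translate (cut_closed cut (~~ b)))
    (@eventually_translate _ g _ _ ev).
  have [v [Dv Dgv]] := eventually_meet ev evg.
  by case: (eqVneq c b) => [cb|]; [case: (empty v);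
    rewrite // cb | case: (c) (b) => [] []].
rewrite {c}bc negbK in empty Dc.
(* [F] is 1 on [S] and nonnegative on [D b]. At a vertex of [D (~~ b)] the preimage is in [D (~~ b)]
   too: a preimage in [S] would put the vertex in [D b], and one in [D b] contradicts [empty]. *)
pose F v : int := (-1) ^+ b * height_defect E D g v.
have F0 v : 0 <= F v.
  rewrite /F /height_defect sg expr0 mul1r mulrBr subr_ge0.
  have [vS|[c Dv]] := cut_cover cut v.
    rewrite (height_cut cut vS) (height_side cut (Dc _ vS)) -signr_addb.
    by rewrite addbN addbb mulr0.
  have [cb|cb] := eqVneq c b.
    by rewrite (height_side cut Dv) cb -signr_addb addbb sgn_height_le1.
  have {}cb : c = ~~ b by case: (c) (b) cb => [] [].
  rewrite {c}cb in Dv; rewrite (height_side cut Dv).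
  have [gvS|[c Dgv]] := cut_cover cut (g^-1%g v).
    have := Db _ gvS; rewrite autKV => /(cut_disjoint cut Dv).
    by case: (b).
  have [cb|cb] := eqVneq c b; first by case: (empty v Dv); rewrite -cb.
  rewrite (height_side cut Dgv); suff -> : c = ~~ b by [].
  by case: (c) (b) cb => [] [].
have [s sS] := cut_nonempty cut.
have Fs : F s = 1.
  rewrite /F /height_defect sg (height_cut cut sS) (height_side cut (Dc _ sS)).
  by case: (b).
apply/eqP => shift0.
have : \sum_(v \in [set: Γ]) F v = 0 by rewrite -mulr_fsumr -/(shift _ _ _)
  shift0 mulr0.
rewrite fsbig_supp => /pfsumr_eq0 F_eq0.
suff : F s = 0 by rewrite Fs.
apply: F_eq0 => //; last by split=> //; rewrite /= Fs.
apply: sub_finite_set (finite_height_defect conn vt cut g) => v [_ /= Fv].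
by apply/eqP => d0; apply: Fv; rewrite /F d0 mulr0.
Qed.

End Displacement.

Section Covering.
Variable Γ : digraph.
Implicit Types (x y : Γ) (g h : aut Γ) (N : set (aut Γ)).

(* B. H. Neumann's covering lemma: finitely many cosets of point stabilisers
   cover a group only if one of the stabilisers has finite index. *)
Lemma finite_orbit_of_cover N (L : seq Γ) (F : seq (Γ * Γ)) :
    N 1%g -> (forall g h, N g -> N h -> N (g * h)%g) ->
    (forall g, N g -> N g^-1%g) ->
    (forall p, p \in F -> p.1 \in L) ->
    (forall g, N g -> exists2 p, p \in F & g p.1 = p.2) ->
  exists2 x, x \in L & finite_set (aut_orbit N x).
Proof.
move=> N1 NM NV; elim: L F => [|x L IH] F FL cov.
  by have [p /FL] := cov _ N1.
have [fin|inf] := pselect (finite_set (aut_orbit N x)).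
  by exists x => //; apply: mem_head.
(* The elements sending [x] to [z] form a coset that pairs with first entry [x] do not touch, so
   pairs based in [L] cover it. *)
have [z [h Nh hx] zF] : exists2 z, aut_orbit N x z & z \notin map snd F.
  apply: contrapT => /forall2NP sub; apply: inf.
  apply: (@sub_finite_set _ _ [set` map snd F]); last exact: finite_seq.
  by move=> z orb; have [//|/negP/negPn] := sub z.
have /choice[y yP] : forall w, exists k : aut Γ, N k /\ (aut_orbit N x w -> k x
  = w).
  move=> w; have [[k Nk kx]|nw] := pselect (aut_orbit N x w).
    by exists k.
  by exists 1%g; split.
pose F1 := [seq p <- F | p.1 \in L].
(* Translates of that cover handle every coset sending [x] to a target of [F], so [F2] covers [N]
   with base points in [L] only. *)
pose F2 := F1 ++ [seq (q.1, y p.2 (h^-1%g q.2)) | p <- F, q <- F1].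
have [||w wL fin] := IH F2; last by exists w; rewrite // inE wL orbT.
  move=> p; rewrite mem_cat => /orP[|/allpairsP[[p' q] [_ /= + ->]] /=].
    by rewrite mem_filter => /andP[].
  by rewrite mem_filter => /andP[].
move=> g Ng; have [p pF gp] := cov g Ng.
have [pL|] := boolP (p.1 \in L).
  by exists p; rewrite // mem_cat mem_filter pL pF.
have := FL _ pF; rewrite inE => /orP[/eqP px _|->//].
have [Ny yx] := yP p.2; have {}yx : y p.2 x = p.2.
  by apply: yx; exists g; rewrite -?px.
(* Left multiplication by [h * (y p.2)^-1] carries [g] into the coset of elements sending [x] to
   [z]. *)
pose k := (h * ((y p.2)^-1 * g))%g.
have [q qF kq] := cov k (NM _ _ Nh (NM _ _ (NV _ Ny) Ng)).
have gE w : g w = y p.2 (h^-1%g (k w)).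
  have -> : h^-1%g (k w) = (y p.2)^-1%g (g w) by exact: (autVK h).
  by rewrite autKV.
have q1F : q \in F1.
  rewrite mem_filter qF andbT; have := FL _ qF; rewrite inE => /orP[/eqP qx|//].
  case/negP: zF; apply/mapP; exists q => //; rewrite -kq qx -hx.
  have gx : g x = y p.2 x by rewrite yx -px.
  by rewrite /k /= gx; congr (h _); exact/esym/(autVK (y p.2) x).
exists (q.1, y p.2 (h^-1%g q.2)); last by rewrite /= gE kq.
by rewrite mem_cat; apply/orP; right; apply/allpairsP; exists (p, q).
Qed.

End Covering.

(** * Quotients by kernels *)

Definition multiplicative_of (G H : groupType) (f : G -> H)
    (fM : {morph f : x y / (x * y)%g}) : {multiplicative G -> H} :=
  HB.pack_for (Multiplicative.type G H) f (isMultiplicative.Build G H f fM).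

Section Kernel.
Variables (G H : groupType) (f : {multiplicative G -> H}).
Local Open Scope group_scope.

Lemma multiplicative1 : f 1 = 1.
Proof. by apply: (mulgI (f 1)); rewrite -gmulfM !mulg1. Qed.

Lemma multiplicativeV x : f x^-1 = (f x)^-1.
Proof. by apply: (mulgI (f x)); rewrite -gmulfM !mulgV multiplicative1. Qed.

Fact kernel_normal : is_normal_in [set g | f g = 1] [set: G].
Proof.
split=> // [|x y fx _];
  last by rewrite /= /conjg !gmulfM fx mul1g -gmulfM mulVg multiplicative1.
split=> [|x y]; rewrite !inE /= ?multiplicative1 // => fx fy.
by rewrite gmulfM multiplicativeV fx fy invg1 mulg1.
Qed.

Definition kernel := NormalSubgroup kernel_normal.

(** First isomorphism theorem. The map on cosets applies [f] to chosen representatives; [f_coset]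
    makes the choice irrelevant. *)
Lemma quotient_kernel_isomorphic : (forall y, exists x, f x = y) ->
  group_isomorphic (quotient_group kernel) H.
Proof.
move=> f_surj; have /choice[rep repP] := @to_coset_surj G kernel.
have f_coset x y : to_coset kernel x = to_coset kernel y <-> f x = f y.
  split=> [/(congr1 (@coset_set _ _)) xy|fxy].
    have : coset_set (to_coset kernel x) x.
      by exists 1; rewrite ?mulg1 //; apply: nsub1.
    by rewrite xy => -[n /= fn <-]; rewrite gmulfM fn mulg1.
  have sub a b : f a = f b ->
      coset_set (to_coset kernel a) `<=` coset_set (to_coset kernel b).
    move=> fab _ [n fn <-]; exists (b^-1 * a * n);
      last by rewrite !mulgA mulgV mul1g.
    by rewrite /= 2!gmulfM multiplicativeV fab fn mulg1 mulVg.
  by apply: coset_ext; apply/seteqP; split; apply: sub.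
have fM : {morph (fun A => f (rep A)) : A B / (A : quotient_group kernel) * B
  >-> A * B}.
  move=> A B; rewrite -gmulfM; apply/f_coset;
    rewrite -repP [in LHS](repP A) [in LHS](repP B).
  exact: to_cosetM.
exists (multiplicative_of fM) => /=.
have /choice[g gK] := f_surj; exists (fun y => to_coset kernel (g y)) => [A|y].
  by rewrite {2}(repP A); apply/f_coset; rewrite gK.
by rewrite -[RHS]gK; apply/f_coset; rewrite -repP.
Qed.

End Kernel.

Section QuotientDigraph.
Variables (Γ Δ : digraph) (N : normal_subgroup (aut Γ)) (phi : Γ -> Δ).

Lemma aut_orbit_refl u : aut_orbit N u u.
Proof. by exists 1%g => //; apply: nsub1. Qed.

Lemma aut_orbit_eq u v : aut_orbit N u = aut_orbit N v <-> aut_orbit N u v.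
Proof.
split=> [->|[n Nn <-]]; first exact: aut_orbit_refl.
apply/seteqP; split=> _ [m Nm <-].
  exists (m * n^-1)%g; first exact/nsubM/nsubV.
  by congr (m _); apply: autVK.
by exists (m * n)%g => //; apply: nsubM.
Qed.

Lemma quotient_digraph_isomorphic :
    (forall u v, phi u = phi v <-> aut_orbit N u v) ->
    (forall i, exists v, phi v = i) ->
    (forall i j, is_arc i j <-> exists u v, [/\ phi u = i, phi v = j & is_arc u
      v]) ->
  digraph_isomorphic (quotient_digraph N) Δ.
Proof.
move=> fibre surj arcs.
have /choice[rep repP] : forall A : quotient_digraph N, exists v,
    orbit_set A = aut_orbit N v.
  by move=> A; apply/asboolP; exact: orbit_typeP A.
have orb A v : orbit_set A v <-> phi v = phi (rep A).
  by rewrite repP -fibre; split.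
exists (fun A => phi (rep A)); split.
  have /choice[lft lftK] := surj.
  exists (fun i => quotient_map N (lft i)) => [A|i].
    apply/val_inj => /=; rewrite [RHS]repP; apply/aut_orbit_eq/fibre.
    exact: lftK.
  rewrite -[RHS]lftK; apply/esym/orb; exact: aut_orbit_refl.
move=> A B; apply/idP/asboolP => [/arcs[u [v [uA vB uv]]]|[u [v [uA vB uv]]]].
  by exists u, v; split=> //; apply/orb.
by apply/arcs; exists u, v; split=> //; apply/orb.
Qed.

End QuotientDigraph.

(** * Subgroups of the integers *)

Lemma int_progression (P : int -> Prop) (m : int) :
  (forall a, P a -> P (a + m)) -> (forall a, P a -> P (a - m)) ->
  forall a k, P a -> P (a + k * m).
Proof.
move=> Pp Pm a k Pa; elim/int_rec: k => [|n IH|n IH].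
- by rewrite mul0r addr0.
- by rewrite intS mulrDl mul1r addrCA [X in P X]addrC; apply: Pp.
by rewrite intS opprD mulrDl mulN1r addrCA [X in P X]addrC; apply: Pm.
Qed.

Lemma int_subgroup_generator (P : int -> Prop) :
  P 0 -> (forall a b, P a -> P b -> P (a - b)) -> (exists2 m, P m & m != 0) ->
  exists2 d, 0 < d & forall a, P a <-> exists k, a = k * d.
Proof.
move=> P0 PB [m Pm m0].
have PN a : P a -> P (- a) by move/(PB _ _ P0); rewrite sub0r.
have PD a b : P a -> P b -> P (a + b) by move=> Pa /PN/(PB _ _ Pa); rewrite opprK.
have ex : exists n, (0 < n)%N && `[< P n%:Z >].
  exists `|m|%N; rewrite absz_gt0 m0; apply/asboolP.
  by case: (ler0P m) => [/lez0_abs ->|/gtz0_abs ->]; [apply: PN|].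
have [d /andP[d0 /asboolP Pd] dmin] := ex_minnP ex.
have PdM a k : P a -> P (a + k * d%:Z).
  by apply: int_progression => b Pb; [apply: PD | apply: PB].
exists d%:Z => // a; split=> [Pa|[k ->]]; last by rewrite -[X in P X]add0r;
  apply: PdM.
exists (a %/ d)%Z; rewrite {1}(divz_eq a d).
have d_neq0 : d%:Z != 0 by rewrite -lt0n.
suff -> : (a %% d)%Z = 0 by rewrite addr0.
have Pr : P (a %% d)%Z by rewrite /modz -mulNr; apply: PdM.
have r0 := modz_ge0 a d_neq0; have rd := ltz_pmod a (d0 : 0 < d%:Z).
apply/eqP/negPn/negP => rn0.
have := dmin `|(a %% d)%Z|%N;
  rewrite absz_gt0 rn0 /= gez0_abs // => /(_ (asboolT Pr)).
by rewrite -lez_nat gez0_abs // leNgt rd.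
Qed.

(** * Actions of dihedral type *)

Section DihedralAction.
Variables (Γ : digraph) (rho : {multiplicative aut Γ -> dihedral_inf}).
Hypotheses (vt : vertex_transitive Γ) (at_ : arc_transitive Γ).
Hypotheses (conn : connected Γ) (infΓ : infinite_set [set: Γ]).
Hypothesis fin_orb : finite_orbits (kernel rho).
Implicit Types (g h : aut Γ) (u v w : Γ).

Lemma rhoM1 g h : (rho (g * h)%g).1 = (rho g).1 + (-1) ^+ (rho g).2 * (rho h).1.
Proof. by rewrite gmulfM. Qed.

Lemma rhoM2 g h : (rho (g * h)%g).2 = (rho g).2 (+) (rho h).2.
Proof. by rewrite gmulfM. Qed.

Lemma rho1 : rho 1%g = (0, false).
Proof. exact: multiplicative1. Qed.

Lemma rhoV2 g : (rho g^-1%g).2 = (rho g).2.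
Proof. by rewrite multiplicativeV. Qed.

(* A translation fixing a vertex would leave only finitely many orbits of the
   kernel. *)
Lemma rho_stabilizer v h : h v = v -> (rho h).2 = false -> (rho h).1 = 0.
Proof.
move=> hv h2; apply/eqP/negPn/negP => h1; apply: infΓ.
set m := (rho h).1 in h1.
have rho_h : rho h = (m, false) by rewrite -h2 -surjective_pairing.
have rho_hV : rho h^-1%g = (- m, false).
  by rewrite multiplicativeV rho_h; congr (_, _); rewrite /= expr0 mul1r.
have hVv : h^-1%g v = v by rewrite -{1}hv; exact: autVK.
have /choice[rep repP] : forall y : int * bool, exists g,
    (exists k, rho k = y) -> rho g = y.
  by move=> y; have [[k ky]|ny] := pselect (exists k, rho k = y);
    [exists k | exists 1%g].
(* Finitely many finite sets will cover the graph: one translate of the kernel orbit of [v] for each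
   residue modulo [m] and each sign. *)
pose Y := \bigcup_(y in `I_`|m| `*` [set: bool])
  (rep (y.1%:Z, y.2) @` aut_orbit (kernel rho) v).
apply: (@sub_finite_set _ _ Y).
  move=> u _; have [g _ <-] := vt (u := v) (v := u) I I.
  pose e := (rho g).2.
  (* Right multiplication by powers of [h] keeps the image of [v] and changes the first coordinate
     by multiples of [m], so the coordinate can be reduced modulo [m]. *)
  pose P (a : int) := exists2 k : aut Γ, k v = g v & rho k = (a, e).
  have Pp a : P a -> P (a + (-1) ^+ e * m).
    move=> [k kv k_rho]; exists (k * h)%g; first by rewrite -kv -{2}hv.
    by rewrite gmulfM k_rho rho_h; congr (_, _); rewrite /= addbF.
  have Pm a : P a -> P (a - (-1) ^+ e * m).
    move=> [k kv k_rho]; exists (k * h^-1)%g; first by rewrite -kv -{2}hVv.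
    by rewrite gmulfM k_rho rho_hV; congr (_, _); rewrite /= (mulrN, addbF).
  have [k kv k_rho] : P ((rho g).1 %% m)%Z.
    rewrite /modz -mulNr; apply: int_progression.
    - by move=> a Pa; case: (e) Pp Pm => Pp Pm; move: (Pp _ Pa) (Pm _ Pa);
        rewrite ?expr0 ?expr1 ?mul1r ?mulN1r ?opprK.
    - by move=> a Pa; case: (e) Pp Pm => Pp Pm; move: (Pp _ Pa) (Pm _ Pa);
        rewrite ?expr0 ?expr1 ?mul1r ?mulN1r ?opprK.
    - by exists g; rewrite // -surjective_pairing.
  have rE : `|((rho g).1 %% m)%Z|%N%:Z = ((rho g).1 %% m)%Z.
    by rewrite gez0_abs // modz_ge0.
  exists (`|((rho g).1 %% m)%Z|%N, e).
    by split=> //=; rewrite -ltz_nat rE ltz_mod.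
  rewrite /= rE; set j := rep _.
  have j_rho : rho j = rho k by rewrite k_rho; apply: repP; exists k.
  exists ((j^-1 * k)%g v); last by rewrite -kv; exact: (autKV j (k v)).
  by exists (j^-1 * k)%g => //=; rewrite gmulfM multiplicativeV j_rho mulVg.
apply: bigcup_finite; first exact: finite_setX.
by move=> y _; apply: finite_image.
Qed.

Variables (v0 w0 : Γ).
Hypothesis arc0 : is_arc v0 w0.

(** Without reflections in the stabiliser, [rho g] depends only on [g v0] and so labels the
    vertices. Along an arc the label is multiplied on the right by [rho x]; connectedness spreads
    [T] from the label of [v0] to all labels. *)
Lemma cayley_invariant (x : aut Γ) (T : dihedral_inf -> Prop) :
    x v0 = w0 -> (forall g, g v0 = v0 -> (rho g).2 = false) ->
    T (0, false) -> (forall y, T y <-> T (y * rho x)%g) ->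
  forall g, T (rho g).
Proof.
move=> xv0 stab T1 TM g.
have rho_eq g1 g2 : g1 v0 = g2 v0 -> rho g1 = rho g2.
  move=> g12; have fix0 : (g1^-1 * g2)%g v0 = v0.
    by rewrite -[RHS](autVK g1 v0) g12.
  have := rho_stabilizer fix0 (stab _ fix0); have := stab _ fix0.
  rewrite gmulfM multiplicativeV => t2 t1; apply/esym/(mulgI (rho g1)^-1%g).
  by rewrite mulVg [LHS]surjective_pairing t1 t2.
pose X u := exists2 g1 : aut Γ, g1 v0 = u & T (rho g1).
suff [g1 g1v Tg1] : X (g v0) by rewrite -(rho_eq _ _ g1v).
apply: (@connected_closed _ X v0) conn _ _; last first.
  by exists 1%g; rewrite // rho1.
move=> u w [g1 g1v Tg1] /orP[] uw; have [g2 [g2v g2w]] := at_ arc0 uw.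
  exists (g2 * x)%g; first by rewrite -g2w -xv0.
  have -> : rho (g2 * x)%g = (rho g1 * rho x)%g.
    by rewrite gmulfM; congr (_ * _)%g; apply: rho_eq; rewrite g2v.
  exact: (TM (rho g1)).1.
exists g2 => //; apply: (TM (rho g2)).2; rewrite -gmulfM.
have -> // : rho (g2 * x)%g = rho g1.
by apply: rho_eq; rewrite g1v -g2w -xv0.
Qed.

(** Otherwise the single element [rho x] would generate the image of [rho]. A reflection generates
    no nontrivial translation, and a translation generates no reflection. *)
Lemma reflection_stabilizer :
  (exists2 g, (rho g).2 = false & (rho g).1 != 0) ->
  (exists g, (rho g).2) -> exists2 s : aut Γ, s v0 = v0 & (rho s).2.
Proof.
move=> [t t2 t1] [r r2]; apply: contrapT => /forall2NP nrefl.
have stab g : g v0 = v0 -> (rho g).2 = false.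
  by move=> gv; have [//|/negP/negPf] := nrefl g.
have [x _ xv0] := vt (u := v0) (v := w0) I I.
case x2 : (rho x).2.
  have xx : (rho x * rho x)%g = (0, false).
    by rewrite [rho x]surjective_pairing x2; congr (_, _);
      rewrite /= expr1 mulN1r subrr.
  have := @cayley_invariant x (fun y => y = (0, false) \/ y = rho x) xv0 stab _
    _ t.
  case; first by left.
  - move=> y; split=> [[->|->]|[] yx].
    + by right; rewrite mul1g.
    + by left.
    + by right; apply: (mulIg (rho x)); rewrite yx xx.
    by left; apply: (mulIg (rho x)); rewrite yx mul1g.
  - by move=> t_rho; rewrite t_rho eqxx in t1.
  by move=> t_rho; rewrite t_rho x2 in t2.
have : (rho r).2 = false; last by rewrite r2.
apply: (@cayley_invariant x (fun y => y.2 = false) xv0 stab) => // y.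
by rewrite /= x2 addbF.
Qed.

(** Recentres the integers at a reflection fixing [v0] and rescales them, so that the translations
    in the image become all integers. *)
Lemma rho_normal_form :
  (exists2 g, (rho g).2 = false & (rho g).1 != 0) ->
  exists t : aut Γ -> int,
    [/\ forall g h, t (g * h)%g = t g + (-1) ^+ (rho g).2 * t h,
        forall g, rho g = (0, false) <-> t g = 0 /\ (rho g).2 = false,
        forall a, exists2 g, (rho g).2 = false & t g = a,
        forall h, h v0 = v0 -> t h = 0 &
        forall g, exists2 s : aut Γ, s v0 = v0 & (rho s).2 = (rho g).2].
Proof.
move=> nontriv.
(* [b] is the first coordinate of a reflection fixing [v0], or 0 if the image contains no
   reflection. *)
have [b bP] : exists b : int, forall g, exists2 s : aut Γ, s v0 = v0 &
    rho s = (if (rho g).2 then b else 0, (rho g).2).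
  have [refl|norefl] := pselect (exists g, (rho g).2).
    have [s sv0 s2] := reflection_stabilizer nontriv refl.
    exists (rho s).1 => g; case: (rho g).2; last by exists 1%g; rewrite ?rho1.
    by exists s => //; rewrite -s2 -surjective_pairing.
  exists 0 => g; exists 1%g => //; rewrite rho1; case E: (rho g).2 => //.
  by case: norefl; exists g.
(* If [g] is a reflection, [q g] is the translation by which [g * s] acts, with [s] the chosen
   reflection at [v0]; so [q] takes values in the translations of the image. *)
pose q g := (rho g).1 - (if (rho g).2 then b else 0).
pose P a := exists g, rho g = (a, false).
have Pq g : P (q g).
  have [s _ s_rho] := bP g; exists (g * s)%g.
  rewrite [LHS]surjective_pairing rhoM1 rhoM2 s_rho addbb /q.
  by case: (rho g).2; rewrite /= ?expr1 ?expr0 ?mulN1r ?mul1r ?addr0 ?subr0.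
have [d d_gt0 dP] : exists2 d, 0 < d & forall a, P a <-> exists k, a = k * d.
  apply: int_subgroup_generator.
  - by exists 1%g; rewrite rho1.
  - move=> a c [g ga] [h hc]; exists (g * h^-1)%g.
    rewrite gmulfM multiplicativeV ga hc; congr (_, _).
    by rewrite /= !expr0 !mul1r.
  by have [g g2 g1] := nontriv; exists (rho g).1 => //; exists g;
    rewrite -g2 -surjective_pairing.
have d0 : d != 0 by rewrite gt_eqF.
have /choice[t tP] : forall g, exists k, q g = k * d by move=> g; apply/dP.
have t_q g a : q g = a * d -> t g = a by rewrite tP => /(mulIf d0).
exists t; split.
- move=> g h; apply: t_q; rewrite mulrDl -mulrA -!tP /q rhoM1 rhoM2.
  case: (rho g).2 (rho h).2 => [] []; rewrite ?expr0 ?expr1 /=; ring.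
- move=> g; split=> [g_rho|[tg g2]].
    by split; [apply: t_q; rewrite /q g_rho subrr mul0r | rewrite g_rho].
  have := tP g; rewrite tg mul0r /q g2 subr0 => g1.
  by rewrite [LHS]surjective_pairing g1 g2.
- move=> a; have [|g ga] := (dP (a * d)).2; first by exists a.
  by exists g; [rewrite ga | apply: t_q; rewrite /q ga subr0].
- move=> h hv0; apply: t_q; rewrite mul0r; have [s sv0 s_rho] := bP h.
  have fix_hs : (h * s)%g v0 = v0 by rewrite -[RHS]hv0 -{2}sv0.
  have := rho_stabilizer fix_hs; rewrite rhoM1 rhoM2 s_rho addbb /q => /(_ erefl).
  by case: (rho h).2; rewrite /= ?expr1 ?expr0 ?mulN1r ?mul1r ?addr0 ?subr0.
by move=> g; have [s sv0 s_rho] := bP g; exists s; rewrite // s_rho.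
Qed.

(** A vertex [v] gets as coordinate [phi v] the value of [t] at an automorphism taking [v0] to [v].
    Arcs change the coordinate by [k] up to sign, and connectedness with surjectivity forces [k] to
    be 1 or -1. *)
Lemma quotient_exists :
  (exists2 g, (rho g).2 = false & (rho g).1 != 0) ->
  exists N : normal_subgroup (aut Γ),
    finite_orbits N /\ (dihedral_case N \/ cyclic_case N).
Proof.
move=> /rho_normal_form[t [tM ker_t t_surj t_stab t_refl]].
have /choice[pos posP] : forall v, exists g : aut Γ, g v0 = v.
  by move=> v; have [g _ gv] := vt (u := v0) (v := v) I I; exists g.
pose phi v := t (pos v).
have phi_v0 g : phi (g v0) = t g.
  have fix0 : (g^-1 * pos (g v0))%g v0 = v0.
    by rewrite -[RHS](autVK g v0); congr (g^-1%g _); apply: posP.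
  rewrite /phi; set p := pos _ in fix0 *.
  have -> : p = (g * (g^-1 * p))%g by rewrite mulgA mulgV mul1g.
  rewrite tM.
  by rewrite (t_stab _ fix0) mulr0 addr0.
have phiM g u : phi (g u) = t g + (-1) ^+ (rho g).2 * phi u.
  by rewrite -{1}(posP u) -tM -phi_v0.
have t1 : t 1%g = 0 by apply: t_stab.
have tV g : t g^-1%g = - ((-1) ^+ (rho g).2 * t g).
  have := tM g^-1%g g; rewrite mulVg t1 rhoV2 => /esym/eqP.
  by rewrite addr_eq0 => /eqP.
have fibre u v : phi u = phi v <->
    exists2 n : aut Γ, t n = 0 /\ (rho n).2 = false & n u = v.
  split=> [uv|[n [tn n2] <-]]; last by rewrite phiM tn n2 mul1r add0r.
  (* The stabiliser element [s] corrects the sign, so that the product below has sign [false]. *)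
  have [s sv0 s2] := t_refl ((pos v)^-1 * pos u)%g.
  exists (pos v * s * (pos u)^-1)%g; last first.
    rewrite -{2}(posP u) -[RHS](posP v) -{2}sv0; congr (pos v (s _)).
    exact: (autVK (pos u)).
  split; last by rewrite !rhoM2 s2 rhoM2 !rhoV2;
    case: (rho _).2 (rho _).2 => [] [].
  have e2 : (rho (pos v * s)%g).2 = (rho (pos u)).2.
    by rewrite rhoM2 s2 rhoM2 rhoV2 addbA addbb.
  rewrite tM e2 tM (t_stab s) // mulr0 addr0 tV mulrN mulrA -signr_addb addbb
    mul1r.
  by rewrite -!/(phi _) uv subrr.
pose k := phi w0.
have arc_step u w : is_arc u w -> exists2 e : bool,
    phi w = phi u + (-1) ^+ e * k & exists2 g : aut Γ, g v0 = u & (rho g).2 = e.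
  move=> uw; have [g [<- <-]] := at_ arc0 uw.
  by exists (rho g).2; [rewrite phiM phi_v0 | exists g].
have k_unit : k = 1 \/ k = -1.
  have kdvd u : (k %| phi u)%Z.
    apply: (@connected_closed _ (fun u => (k %| phi u)%Z) v0) conn _ _;
      last first.
      by rewrite -[v0]/((1%g : aut Γ) v0) phi_v0 t1 dvdz0.
    move=> x y kx /orP[] /arc_step[e xy _].
      by rewrite xy rpredD // dvdz_mull.
    by rewrite xy rpredDr // dvdz_mull in kx.
  have [g _ tg] := t_surj 1; have := kdvd (g v0); rewrite phi_v0 tg dvdz1.
  by case: (k) => -[|[|]]//=; auto.
have surj i : exists v, phi v = i.
  by have [g _ <-] := t_surj i; exists (g v0).
have orbE (N : normal_subgroup (aut Γ)) :
    (forall g, normal_set N g <-> t g = 0 /\ (rho g).2 = false) ->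
    finite_orbits N /\ forall u v, phi u = phi v <-> aut_orbit N u v.
  move=> NE; have -> : normal_set N = kernel rho.
    by apply/seteqP; split=> g; rewrite /= ker_t NE.
  split=> // u v; rewrite fibre; split=> -[n nP nu]; exists n => //; exact/ker_t.
have [[r r2]|norefl] := pselect (exists g, (rho g).2).
  pose rho' g : dihedral_inf := (t g, (rho g).2).
  have rho'M : {morph rho' : g h / (g * h)%g}.
    by move=> g h; rewrite /rho' tM rhoM2.
  exists (kernel (multiplicative_of rho'M)).
  have [g|fin orb] := orbE (kernel (multiplicative_of rho'M)).
    by split=> [[-> ->]|[t0 e0]] //=; congr (_, _).
  split=> //; left; split.
    apply: (quotient_digraph_isomorphic (phi := phi : Γ -> Zdigraph)) => // i j.
    split=> [ij|[u [v [<- <- /arc_step[e -> _]]]]]; last first.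
      by apply/orP; case: k_unit => ->; case: e; [right|left|left|right];
        apply/eqP; rewrite ?expr0 ?expr1; ring.
    have [g g2 tg] := t_surj i; have [s sv0 s2] := t_refl r.
    (* Both signs occur above each integer, so every layer sends arcs up and down. *)
    have sgn (e : bool) : exists2 h : aut Γ, phi (h v0) = i & (rho h).2 = e.
      case: e; last by exists g; rewrite ?phi_v0.
      by exists (g * s)%g; rewrite ?rhoM2 ?g2 ?s2 ?r2 // phi_v0 tM (t_stab s)
        // mulr0 addr0.
    have [e ke] : exists e : bool, j = i + (-1) ^+ e * k.
      by case/orP: ij => /eqP ->; case: k_unit => ->;
        [exists false|exists true|exists true|exists false];
          rewrite ?expr0 ?expr1; ring.
    have [h hi h2] := sgn e; exists (h v0), (h w0); split=> //;
      last by rewrite aut_arc.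
    by rewrite ke -hi phi_v0 phiM h2.
  apply: quotient_kernel_isomorphic => -[a e] /=.
  have [g g2 <-] := t_surj a; case: e; last by exists g; rewrite /rho' g2.
  have [s sv0 s2] := t_refl r; exists (g * s)%g.
  by rewrite /rho' tM rhoM2 g2 s2 r2 (t_stab s) // mulr0 addr0.
have e0 g : (rho g).2 = false by apply/negP => r2; apply: norefl; exists g.
have tM' : {morph (t : aut Γ -> Zgroup) : g h / (g * h)%g}.
  by move=> g h; rewrite tM e0 expr0 mul1r.
exists (kernel (multiplicative_of tM')).
have [g|fin orb] := orbE (kernel (multiplicative_of tM')).
  by split=> [|[]].
split=> //; right; split; last first.
  by apply: quotient_kernel_isomorphic => a; have [g _ <-] := t_surj a; exists g.
have kk : k * k = 1 by case: k_unit => ->.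
(* The factor [k] orients the coordinate so that arcs go upwards. *)
apply: (quotient_digraph_isomorphic (phi := (fun v => k * phi v) : Γ -> Zvec)).
- move=> u v; rewrite -orb; split=> [|-> //] /(congr1 (fun x => k * x)).
  by rewrite !mulrA kk !mul1r.
- by move=> i; have [v vi] := surj (k * i); exists v; rewrite vi mulrA kk mul1r.
move=> i j; split=> [/eqP ->|[u [v [<- <- /arc_step[e -> [g _ <-]]]]]];
  last first.
  by rewrite e0 expr0 mul1r mulrDr kk; apply/eqP.
have [g _ tg] := t_surj (k * i); exists (g v0), (g w0); split.
- by rewrite phi_v0 tg mulrA kk mul1r.
- by rewrite phiM e0 expr0 mul1r mulrDr tg mulrA kk mul1r.
by rewrite aut_arc.
Qed.

End DihedralAction.

(** * The quotient of a two-ended digraph *)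

Lemma two_ended_quotient (Γ : digraph) :
  vertex_transitive Γ -> arc_transitive Γ -> two_ended Γ ->
  exists N : normal_subgroup (aut Γ),
    finite_orbits N /\ (dihedral_case N \/ cyclic_case N).
Proof.
move=> vt at_ te; have [conn _] := te.
have [E [S [D cut]]] := two_ended_cut te.
pose rho g : dihedral_inf := (shift E D g, swaps E g).
have rhoM : {morph rho : g h / (g * h)%g}.
  move=> g h; rewrite /rho (shiftM conn vt cut).
  by rewrite (swapsM cut).
pose K := kernel (multiplicative_of rhoM).
have [inj_r adj_r] := cut_ray cut false.
have infΓ : infinite_set [set: Γ].
  move=> fin; apply: infinite_nat.
  apply: (finite_preimage (f := E false) _ fin).
  by move=> m n _ _; apply: inj_r.
have fin_stab : finite_orbits K.
  (* An element of [K] has shift 0, so it cannot move [S] off itself: it maps some vertex of [S]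
     into [S], and the pairs from [S] cover [K]. *)
  have [|||||s sS fin] := @finite_orbit_of_cover _ (normal_set K) S
      [seq (s, s') | s <- S, s' <- S].
  - exact: nsub1.
  - by move=> g h; apply: nsubM.
  - by move=> g; apply: nsubV.
  - by move=> _ /allpairsP[[s s'] [/= sS _ ->]].
  - move=> g [shift0 swaps0]; apply: contrapT => nmeet.
    have := shift_neq0 conn vt cut swaps0; rewrite shift0 eqxx => H.
    suff // : false by []. apply: H => s sS; apply/negP => gsS; apply: nmeet.
    by exists (s, g s) => //; apply/allpairsP; exists (s, g s).
  move=> v; have [g _ <-] := vt s v I I.
  apply: sub_finite_set (finite_image g fin) => _ [n Kn <-].
  exists ((n ^ g)%g s); first by exists (n ^ g)%g => //; apply: nsubJ.
  by rewrite /conjg; exact: (autKV g (n (g s))).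
have [u [w uw]] : exists u w : Γ, is_arc u w.
  have /orP[uw|uw] := adj_r 0%N; first by exists (E false 0%N), (E false 1%N).
  by exists (E false 1%N), (E false 0%N).
apply: (quotient_exists vt at_ conn infΓ fin_stab uw).
(* Without a nontrivial translation [K] would have index at most 2, and the vertex set would be
   finite. *)
apply: contrapT => /forall2NP triv.
have K_swaps g : swaps E g = false -> normal_set K g.
  move=> g2; have [//|/negP/negPn/eqP /= g1] := triv g.
  by congr (_, _).
apply: infΓ; have [[r r2]|norefl] := pselect (exists r, swaps E r); last first.
  apply: sub_finite_set (fin_stab u) => v _; have [g _ gv] := vt u v I I.
  exists g => //; apply: K_swaps; apply/negbTE/negP => g2.
  by apply: norefl; exists g.
apply: (@sub_finite_set _ _ (aut_orbit K u `|` r @` aut_orbit K u)).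
  move=> v _; have [g _ gv] := vt u v I I.
  case g2 : (swaps E g); last by left; exists g => //; apply: K_swaps.
  right; exists ((r^-1 * g)%g u); last by rewrite -gv; exact: (autKV r (g u)).
  exists (r^-1 * g)%g => //; apply: K_swaps.
  have := swapsM cut r (r^-1 * g)%g; rewrite mulgA mulgV mul1g g2 r2.
  by case: swaps.
by rewrite finite_setU; split; [|apply: finite_image]; apply: fin_stab.
Qed.

(** * Fibres of the quotient map and counting *)

Lemma card_seq (T : choiceType) (s : seq T) : uniq s -> [set` s] #= `I_(size s).
Proof.
move=> us; have -> : [set` s] = [set` [fset x in s]%fset].
  by apply/seteqP; split=> x; rewrite /= inE.
by apply/card_eq_fsetP; rewrite card_fseq undup_id.
Qed.

Lemma finite_set_uniq_seq (T : choiceType) (A : set T) : finite_set A ->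
  exists2 s : seq T, uniq s & A = [set` s].
Proof.
move=> /finite_seqP[s ->]; exists (undup s); first exact: undup_uniq.
by apply/seteqP; split=> x; rewrite /= mem_undup.
Qed.

Lemma card_setU_disjoint (T : choiceType) (A B : set T) (a b : nat) :
  (forall x, A x -> B x -> False) -> A #= `I_a -> B #= `I_b ->
  A `|` B #= `I_(a + b).
Proof.
move=> AB Aa Bb.
have [s us As] := finite_set_uniq_seq (ex_intro _ a Aa : finite_set A).
have [s' us' Bs] := finite_set_uniq_seq (ex_intro _ b Bb : finite_set B).
have -> : a = size s.
  by apply/card_eq_II; rewrite -(card_eql Aa) As card_seq.
have -> : b = size s'.
  by apply/card_eq_II; rewrite -(card_eql Bb) Bs card_seq.
have -> : A `|` B = [set` s ++ s'].
  rewrite As Bs; apply/seteqP; split=> x /=; rewrite mem_cat;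
    first by move=> [->//|->]; rewrite orbT.
  by move/orP.
rewrite -size_cat; apply: card_seq; rewrite cat_uniq us us' andbT /=.
by apply/hasPn => x xs'; apply/negP => xs; apply: (AB x); rewrite (As, Bs).
Qed.

Lemma double_count (T U : eqType) (X : seq T) (Y : seq U) (r : T -> U -> bool)
  (a b : nat) :
  (forall x, x \in X -> count (r x) Y = a) ->
  (forall y, y \in Y -> count (r^~ y) X = b) -> (size X * a = size Y * b)%N.
Proof.
move=> Xa Yb; transitivity (\sum_(x <- X) \sum_(y <- Y) r x y)%N.
  rewrite -sum1_size big_distrl /= big_seq [RHS]big_seq; apply: eq_bigr => x xX.
  by rewrite mul1n -(Xa x xX) -sum1_count [LHS]big_mkcond;
    apply: eq_bigr => y _; case: (r x y).
rewrite exchange_big /= -sum1_size big_distrl /= big_seq [RHS]big_seq.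
apply: eq_bigr => y yY.
by rewrite mul1n -(Yb y yY) -sum1_count [RHS]big_mkcond; apply: eq_bigr => x _;
  case: (r x y).
Qed.

Section QuotientMap.
Variables (Γ Δ : digraph) (N : normal_subgroup (aut Γ)) (phi : Γ -> Δ).
Hypothesis phiN : isom_after_quotient N phi.

Lemma quotient_fibre u v : phi u = phi v <-> aut_orbit N u v.
Proof.
have [h [hbij _] hE] := phiN; rewrite -aut_orbit_eq !hE; split.
  by move/(bij_inj hbij)/(congr1 (@orbit_set _ _)).
by move=> uv; congr h; apply/val_inj.
Qed.

Lemma quotient_surj i : exists v, phi v = i.
Proof.
have [h [[h' hK h'K] _] hE] := phiN; have /asboolP[v vE] := orbit_typeP (h' i).
by exists v; rewrite hE -[RHS]h'K; congr h; apply/val_inj.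
Qed.

Lemma quotient_arc i j :
  is_arc i j <-> exists u v, [/\ phi u = i, phi v = j & is_arc u v].
Proof.
have [h [hbij arc_h] hE] := phiN; split=> [|[u [v [<- <- uv]]]]; last first.
  rewrite !hE arc_h; apply/asboolP; exists u, v.
  by split=> //; apply: aut_orbit_refl.
have [u <-] := quotient_surj i; have [v <-] := quotient_surj j.
rewrite !hE arc_h => /asboolP[u' [v' [/quotient_fibre uu /quotient_fibre vv uv]]].
by exists u', v'; rewrite -!hE uu vv.
Qed.

(** [N] is transitive on each fibre, so an arc of the quotient lifts to one starting at any
    prescribed vertex. *)
Lemma quotient_out u j : is_arc (phi u) j -> exists2 w, is_arc u w & phi w = j.
Proof.
move=> /quotient_arc[u' [w [/quotient_fibre[n Nn <-] <- uw]]].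
by exists (n w); [rewrite aut_arc | apply/esym/quotient_fibre; exists n].
Qed.

Lemma quotient_in u j : is_arc j (phi u) -> exists2 w, is_arc w u & phi w = j.
Proof.
move=> /quotient_arc[w [u' [<- /quotient_fibre[n Nn <-] uw]]].
by exists (n w); [rewrite aut_arc | apply/esym/quotient_fibre; exists n].
Qed.

Lemma quotient_block (g : aut Γ) u v : phi (g u) = phi (g v) <-> phi u = phi v.
Proof.
have sub (h : aut Γ) x y : phi x = phi y -> phi (h x) = phi (h y).
  move=> /quotient_fibre[n Nn <-]; apply/quotient_fibre.
  exists (n ^ h^-1)%g; first exact: nsubJ.
  rewrite /conjg invgK; congr (h (n _)); exact: (autVK h).
by split; [rewrite -{2}(autVK g u) -{2}(autVK g v)|]; apply: sub.
Qed.

End QuotientMap.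

(** Adjacent vertices of [Zdigraph] are joined by arcs both ways, those of [Zvec] never. *)
Lemma dihedral_cyclic_excl (Γ : digraph) (N : normal_subgroup (aut Γ)) :
  dihedral_case N -> cyclic_case N -> False.
Proof.
move=> [[f [[f' fK f'K] arc_f]] _] [[g [_ arc_g]] _].
have ab : is_arc (f' (0 : int)) (f' (1 : int)) by rewrite -arc_f !f'K.
have ba : is_arc (f' (1 : int)) (f' (0 : int)) by rewrite -arc_f !f'K.
move: ab ba; rewrite -!arc_g => /eqP -> /eqP; lia.
Qed.

Lemma induced_aut (Γ : digraph) (W : set Γ) (g : aut Γ) :
    (forall u, W (g u) <-> W u) ->
  exists h : aut (induced W), forall x, val (h x) = g (val x).
Proof.
move=> Wg; have Wgm u : u \in W -> g u \in W by rewrite !inE => /Wg.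
have WgVm u : u \in W -> g^-1%g u \in W.
  by rewrite !inE => Wu; apply/(Wg (g^-1%g u)); rewrite autKV.
pose f (x : induced W) : induced W := SigSub (Wgm _ (valP x)).
pose f' (x : induced W) : induced W := SigSub (WgVm _ (valP x)).
have isof : `[< digraph_isom f >].
  apply/asboolP; split; last by move=> x y; rewrite /= aut_arc.
  by exists f' => x; apply/val_inj; [apply: autVK | apply: autKV].
by exists (Aut isof).
Qed.

Section Layers.
Variables (Γ : digraph) (N : normal_subgroup (aut Γ)) (phi : Γ -> int).
Hypotheses (vt : vertex_transitive Γ) (at_ : arc_transitive Γ).
Hypothesis fin_orb : finite_orbits N.
Hypothesis fibre : forall u v, phi u = phi v <-> aut_orbit N u v.
Hypothesis block : forall (g : aut Γ) u v, phi (g u) = phi (g v) <-> phi u =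
  phi v.
Implicit Types (g : aut Γ) (u v w x y : Γ) (i : int).

Local Notation L i := (phi @^-1` [set i]).

Lemma layer_seq v : exists2 s : seq Γ, uniq s & forall x, (x \in s) = (phi x ==
  phi v).
Proof.
have [s us sE] := finite_set_uniq_seq (fin_orb v).
exists s => // x; apply/idP/eqP => [xs|/esym/fibre vx].
  by apply/esym/fibre; rewrite sE.
by move: vx; rewrite sE.
Qed.

(** Count the arcs from the layer of [v] to that of [w] in two ways. [N] is transitive on each
    layer, so the counts are constant, and vertex-transitivity gives the layers equal size. *)
Lemma out_in_layer_card v w :
  out_nbrs v `&` L (phi w) #= in_nbrs w `&` L (phi v).
Proof.
have [X uX XE] := layer_seq v; have [Y uY YE] := layer_seq w.
have vX : v \in X by rewrite XE.
have -> : out_nbrs v `&` L (phi w) = [set` filter (is_arc v) Y].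
  apply/seteqP; split=> y; rewrite /= mem_filter YE; first by move=> [-> ->];
    rewrite eqxx.
  by move=> /andP[? /eqP].
have -> : in_nbrs w `&` L (phi v) = [set` filter (fun x => is_arc x w) X].
  apply/seteqP; split=> x; rewrite /= mem_filter XE; first by move=> [-> ->];
    rewrite eqxx.
  by move=> /andP[? /eqP].
rewrite (card_eql (card_seq (filter_uniq _ uY))) (card_eqr (card_seq
  (filter_uniq _ uX))).
rewrite !size_filter; apply/card_eq_II.
have map_layer g (s : seq Γ) (r r' : pred Γ) : uniq s ->
    (forall x, r' (g x) = r x) -> (forall x, (g x \in s) = (x \in s)) ->
    count r' s = count r s.
  move=> us rg sg; rewrite -!size_filter -[RHS](size_map g).
  apply: perm_size; apply: uniq_perm.
  - exact: filter_uniq.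
  - by rewrite map_inj_uniq; [apply: filter_uniq | apply: aut_inj].
  move=> x; rewrite mem_filter -(autKV g x) (mem_map (@aut_inj _ g)).
  by rewrite mem_filter rg sg.
have phi_n n x : normal_set N n -> phi (n x) = phi x.
  by move=> Nn; apply/esym/fibre; exists n.
have size_eq : size X = size Y.
  have [g _ gv] := vt (u := v) (v := w) I I.
  rewrite -(size_map g); apply: perm_size; apply: uniq_perm => //.
    by rewrite map_inj_uniq //; apply: aut_inj.
  move=> x; rewrite -(autKV g x) (mem_map (@aut_inj _ g)) XE YE -gv.
  by apply/eqP/eqP => /block.
suff /eqP : (size Y * count (is_arc v) Y = size Y * count (fun x => is_arc x w)
  X)%N.
  rewrite eqn_mul2l; have -> : (size Y == 0)%N = false.
    by rewrite -size_eq; case: (X) vX.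
  by move/eqP.
rewrite -{1}size_eq; apply: (@double_count _ _ X Y (fun x y => is_arc x y)).
  move=> x; rewrite XE => /eqP/esym/fibre[n Nn <-].
  by apply: (map_layer n) => // y; rewrite ?aut_arc // !YE phi_n.
move=> y; rewrite YE => /eqP/esym/fibre[n Nn <-].
by apply: (map_layer n) => // x; rewrite ?aut_arc // !XE phi_n.
Qed.

Lemma nbrs_card_vertex v w :
  in_nbrs v #= in_nbrs w /\ out_nbrs v #= out_nbrs w.
Proof.
have [g _ gv] := vt (u := v) (v := w) I I.
have -> : in_nbrs w = g @` in_nbrs v.
  apply/seteqP; split=> [x xw|_ [x xv <-]];
    last by rewrite -gv /in_nbrs /= aut_arc.
  exists (g^-1%g x); last exact: autKV.
  by rewrite /in_nbrs /= -(aut_arc g) autKV gv.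
have -> : out_nbrs w = g @` out_nbrs v.
  apply/seteqP; split=> [x xw|_ [x xv <-]];
    last by rewrite -gv /out_nbrs /= aut_arc.
  exists (g^-1%g x); last exact: autKV.
  by rewrite /out_nbrs /= -(aut_arc g) autKV gv.
by split; apply/card_esym/inj_card_eq => x y _ _; apply: aut_inj.
Qed.

Hypothesis arc_step : forall u w, is_arc u w ->
  phi w = phi u + 1 \/ phi w = phi u - 1.

Lemma layers_bipartite i : bipartite (induced (L i `|` L (i + 1))).
Proof.
exists (fun x : induced (L i `|` L (i + 1)) => phi (val x) == i) => x y xy.
have Wx : (L i `|` L (i + 1)) (val x) by apply: set_mem; apply: valP.
have Wy : (L i `|` L (i + 1)) (val y) by apply: set_mem; apply: valP.
have {}xy : phi (val y) = phi (val x) + 1 \/ phi (val y) = phi (val x) - 1.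
  case/orP: xy => [/arc_step//|/arc_step[]->]; [right|left]; ring.
case: Wx Wy => [] /= xE [] /= yE; rewrite xE yE in xy *; lia.
Qed.

(** The end vertices of any arc in the two layers determine both, so an automorphism carrying one
    such arc to another preserves their union. *)
Lemma layers_arc_transitive i : arc_transitive (induced (L i `|` L (i + 1))).
Proof.
move=> x y x' y' xy xy'.
have W z : (L i `|` L (i + 1)) (val (z : induced (L i `|` L (i + 1)))).
  by apply: set_mem; apply: valP.
have [g [gx gy]] := at_ xy xy'.
have pair (a b : Γ) : (L i `|` L (i + 1)) a -> (L i `|` L (i + 1)) b -> is_arc
  a b ->
    forall u, (L i `|` L (i + 1)) u <-> phi u = phi a \/ phi u = phi b.
  by move=> [] /= aE [] /= bE /arc_step; rewrite aE bE => ab u;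
    split=> -[] /= ->; lia.
have [|h hE] := @induced_aut _ (L i `|` L (i + 1)) g.
  move=> u; apply: (iff_trans (pair _ _ (W x') (W y') xy' _)).
  rewrite -gx -gy; apply: iff_sym; apply: (iff_trans (pair _ _ (W x) (W y) xy _)).
  by rewrite !block.
by exists h; split; apply/val_inj; rewrite hE.
Qed.

End Layers.

(** * The dihedral case *)

Section DihedralLayers.
Variables (Γ : digraph) (N : normal_subgroup (aut Γ)) (phi : Γ -> int).
Hypotheses (vt : vertex_transitive Γ) (at_ : arc_transitive Γ).
Hypotheses (conn : connected Γ) (fin_orb : finite_orbits N).
Hypothesis phiN : isom_after_quotient N (phi : Γ -> Zdigraph).
Implicit Types (g : aut Γ) (u v w x y : Γ) (i j : int).

Local Notation L i := (phi @^-1` [set i]).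

Lemma phi_block g u v : phi (g u) = phi (g v) <-> phi u = phi v.
Proof. exact: (quotient_block phiN). Qed.

Lemma phi_fibre u v : phi u = phi v <-> aut_orbit N u v.
Proof. exact: (quotient_fibre phiN). Qed.

Lemma phi_arc u w : is_arc u w -> phi w = phi u + 1 \/ phi w = phi u - 1.
Proof.
move=> uw; have := (quotient_arc phiN (phi u) (phi w)).2 (ex_intro _ u
  (ex_intro _ w (And3 erefl erefl uw))).
by case/orP => /eqP ->; [left | right; rewrite addrK].
Qed.

Lemma phi_out u j : j = phi u + 1 \/ j = phi u - 1 ->
  exists2 w, is_arc u w & phi w = j.
Proof.
move=> uj; apply: (quotient_out phiN); apply/orP.
by case: uj => ->; [left | right; rewrite subrK].
Qed.

Lemma phi_in u j : j = phi u + 1 \/ j = phi u - 1 ->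
  exists2 w, is_arc w u & phi w = j.
Proof.
move=> uj; apply: (quotient_in phiN); apply/orP.
by case: uj => ->; [right | left; rewrite subrK].
Qed.

(** Take an automorphism carrying an upward arc at [v] to a downward one. Layers are blocks, so it
    exchanges the two adjacent layers. *)
Lemma layer_reflection v : exists g, [/\ g v = v,
  forall u, phi u = phi v - 1 -> phi (g u) = phi v + 1 &
  forall u, phi u = phi v + 1 -> phi (g u) = phi v - 1].
Proof.
have [w vw wE] := @phi_out v _ (or_introl erefl).
have [w' vw' w'E] := @phi_out v _ (or_intror erefl).
have [g [gv gw]] := at_ vw vw'.
exists g; split=> // u uE; last first.
  by rewrite -w'E -gw; apply/phi_block; rewrite uE wE.
have -> : phi (g u) = phi (g w') by apply/phi_block; rewrite uE w'E.
have := phi_arc (_ : is_arc v (g w'));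
  rewrite -{1}gv aut_arc => /(_ vw')[] // gw'E.
have : phi w' = phi w by apply/(phi_block g); rewrite gw gw'E w'E.
by rewrite w'E wE; lia.
Qed.

Lemma reflection_card v (R : set Γ) :
    (forall u, R u -> phi u = phi v + 1 \/ phi u = phi v - 1) ->
    (forall g u, g v = v -> R (g u) <-> R u) ->
  R `&` L (phi v - 1) #= R `&` L (phi v + 1).
Proof.
move=> Rnbr Rg; have [g [gv gdown gup]] := layer_reflection v.
have -> : R `&` L (phi v + 1) = g @` (R `&` L (phi v - 1)).
  apply/seteqP; split=> [y [Ry /= yE]|_ [x [Rx /= xE] <-]]; last first.
    by split; [apply/(Rg g x gv) | apply: gdown].
  have Rgy : R (g^-1%g y) by apply/(Rg g _ gv); rewrite autKV.
  exists (g^-1%g y); last exact: autKV.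
  split=> //=; case: (Rnbr _ Rgy) => // /gup.
  by rewrite autKV yE; lia.
by apply/card_esym/inj_card_eq => x y _ _; apply: aut_inj.
Qed.

Lemma reflection_out_card v :
  out_nbrs v `&` L (phi v - 1) #= out_nbrs v `&` L (phi v + 1).
Proof.
by apply: reflection_card => [u /phi_arc|g u gv];
  rewrite // /out_nbrs /= -{1}gv aut_arc.
Qed.

Lemma reflection_in_card v :
  in_nbrs v `&` L (phi v - 1) #= in_nbrs v `&` L (phi v + 1).
Proof.
apply: reflection_card => [u /phi_arc|g u gv];
  last by rewrite /in_nbrs /= -{1}gv aut_arc.
by case=> ->; [right | left]; ring.
Qed.

Lemma split_layers v (R : set Γ) :
    (forall u, R u -> phi u = phi v + 1 \/ phi u = phi v - 1) ->
  R = (R `&` L (phi v - 1)) `|` (R `&` L (phi v + 1)).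
Proof.
move=> Rnbr; apply/seteqP; split=> [u Ru|u [[]|[]] //].
by case: (Rnbr u Ru) => uE; [right | left].
Qed.

Lemma half_card v (R : set Γ) a :
    (forall u, R u -> phi u = phi v + 1 \/ phi u = phi v - 1) ->
    R `&` L (phi v - 1) #= R `&` L (phi v + 1) ->
    R `&` L (phi v + 1) #= `I_a ->
  R #= `I_(a + a).
Proof.
move=> Rnbr Req Ra; rewrite (split_layers Rnbr); apply: card_setU_disjoint => //.
  by move=> u [_ /= ->] [_ /=]; lia.
exact: card_eq_trans Ra.
Qed.

Lemma out_nbrs_step v u : out_nbrs v u -> phi u = phi v + 1 \/ phi u = phi v - 1.
Proof. exact: phi_arc. Qed.

Lemma in_nbrs_step v u : in_nbrs v u -> phi u = phi v + 1 \/ phi u = phi v - 1.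
Proof. by move=> /phi_arc[] ->; [right | left]; ring. Qed.

(** A reflection at [v] equates up with down, and double counting between consecutive layers equates
    out with in. *)
Lemma nbrs_card : exists a, forall v,
  [/\ out_nbrs v `&` L (phi v - 1) #= `I_a, out_nbrs v `&` L (phi v + 1) #= `I_a,
      in_nbrs v `&` L (phi v - 1) #= `I_a, in_nbrs v `&` L (phi v + 1) #= `I_a &
      out_nbrs v #= `I_(a + a) /\ in_nbrs v #= `I_(a + a)].
Proof.
have up v : exists a, out_nbrs v `&` L (phi v + 1) #= `I_a.
  have [w _ wE] := @phi_out v _ (or_introl erefl).
  apply/finite_setP; rewrite -wE;
    apply: sub_finite_set (fin_orb w) => x [_ /= xE].
  by apply/phi_fibre; rewrite xE.
have [v0 _] : exists v0, phi v0 = 0 by apply: (quotient_surj phiN (0 : int)).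
have [a Ha] := up v0; exists a.
have out_a v : out_nbrs v `&` L (phi v + 1) #= `I_a.
  have [b Hb] := up v; suff -> : a = b by [].
  (* The out-valency is twice the number of out-neighbours above and is the same at all vertices. *)
  have ca := half_card (@out_nbrs_step v0) (reflection_out_card v0) Ha.
  have cb := half_card (@out_nbrs_step v) (reflection_out_card v) Hb.
  have [_ c] := nbrs_card_vertex vt v0 v.
  suff : (a + a = b + b)%N by lia.
  by apply/card_eq_II; rewrite -(card_eql ca) (card_eql c).
have in_a v : in_nbrs v `&` L (phi v - 1) #= `I_a.
  have [w wv wE] := @phi_in v _ (or_intror erefl).
  have := out_in_layer_card vt fin_orb phi_fibre phi_block w v.
  rewrite wE => /card_esym/card_eq_trans; apply.
  have -> : phi v = phi w + 1 by rewrite wE subrK.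
  exact: out_a.
move=> v; have inup : in_nbrs v `&` L (phi v + 1) #= `I_a.
  by rewrite -(card_eql (reflection_in_card v)).
split=> //; first by rewrite (card_eql (reflection_out_card v)).
split; first exact: half_card (@out_nbrs_step v) (reflection_out_card v) (out_a
  v).
exact: half_card (@in_nbrs_step v) (reflection_in_card v) inup.
Qed.

Lemma fixes_layers g v w : g v = v -> phi w = phi v + 1 -> phi (g w) = phi w ->
  forall u, phi (g u) = phi u.
Proof.
move=> gv wE gw u; pose Fx j := forall u, phi u = j -> phi (g u) = j.
have Fx_phi x : phi (g x) = phi x -> Fx (phi x).
  by move=> gx y yx; rewrite -gx; apply/phi_block.
(* Two adjacent preserved layers force the next one: its vertices move to a layer adjacent to
   [j + (-1) ^+ e], and layer [j] is taken. *)
have step (e : bool) j : Fx j -> Fx (j + (-1) ^+ e) -> Fx (j + (-1) ^+ e + (-1)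
  ^+ e).
  move=> Fj Fj' x xE.
  have [|y xy yE] := @phi_out x (j + (-1) ^+ e).
    by rewrite xE; case: (e); [left|right]; rewrite ?expr0 ?expr1; ring.
  have gxy : is_arc (g x) (g y) by rewrite aut_arc.
  have gyE := Fj' _ yE; have [z zE] : exists z, phi z = j.
    exact: (quotient_surj phiN (j : int)).
  have xz : phi (g x) <> j.
    by rewrite -(Fj z zE) => /phi_block; rewrite xE zE; case: (e);
      rewrite ?expr0 ?expr1; lia.
  move: (phi_arc gxy) xz; rewrite gyE; case: (e); rewrite ?expr0 ?expr1; lia.
pose P k := Fx k /\ Fx (k + 1).
have P0 : P (phi v).
  by split; [apply: Fx_phi; rewrite gv | rewrite -wE; apply: Fx_phi].
have : P (phi v + (phi u - phi v) * 1).
  apply: int_progression P0 => k [Fk Fk1].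
    by split=> //; have := step false k; rewrite expr0; apply.
  split; last by rewrite subrK.
  by have := step true (k + 1); rewrite expr1 addrK; apply.
by rewrite mulr1 addrC subrK => -[+ _]; apply.
Qed.

(** A stabiliser element is determined by whether it exchanges the two adjacent layers. Two elements
    that agree in this differ by one fixing all layers, which is trivial because its fixed points
    spread to their neighbours. *)
Lemma stabilizer_card_le2 :
    (forall g v, g v = v -> (forall u, phi (g u) = phi u) ->
       forall u, adj v u -> g u = u) ->
  forall v, stabilizer v #<= `I_2.
Proof.
move=> fixN v; have [w vw wE] := @phi_out v _ (or_introl erefl).
have trivial g : g v = v -> phi (g w) = phi w -> g = 1%g.
  move=> gv gw; have g_phi := fixes_layers gv wE gw; apply: aut_ext => u.
  apply: (@connected_closed _ (fun u => g u = u) v) conn _ gv => x y gx.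
  exact: fixN.
pose f g : nat := phi (g w) != phi w.
have f_inj : {in stabilizer v &, injective f}.
  move=> g h; rewrite !inE /stabilizer /= => gv hv fgh.
  have nbr (k : aut Γ) : k v = v -> phi (k w) = phi v + 1 \/ phi (k w) = phi v
    - 1.
    by move=> kv; rewrite -{1 2}kv; apply: phi_arc; rewrite aut_arc.
  have gh : phi (g w) = phi (h w).
    by move: fgh (nbr g gv) (nbr h hv); rewrite /f wE; do 2 case: eqP; lia.
  have fix_v : (g^-1 * h)%g v = v by rewrite -[RHS](autVK g v) gv -{2}hv.
  have : (g^-1 * h)%g = 1%g.
    apply: trivial => //; rewrite -[in RHS](autVK g w).
    by apply/(phi_block g^-1%g).
  by move/(congr1 (fun k => g * k)%g); rewrite mulgA mulgV mul1g mulg1.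
rewrite -(card_le_eql (inj_card_eq f_inj)); apply: subset_card_le => _ [g _ <-].
by rewrite /f /=; case: (_ != _).
Qed.

End DihedralLayers.

Lemma card_I1_eq (T : choiceType) (A : set T) x y :
  A #= `I_1 -> A x -> A y -> x = y.
Proof.
move=> A1; have [s us As] := finite_set_uniq_seq (ex_intro _ 1%N A1 :
  finite_set A).
have : size s = 1%N by apply/card_eq_II; rewrite -(card_eql (card_seq us)) -As.
by rewrite As; case: s {us As} => [|z []] //= _; rewrite !inE => /eqP-> /eqP->.
Qed.

(** * Layers, valencies and stabilisers *)

Theorem corollary9 (Γ : digraph) :
  vertex_transitive Γ -> arc_transitive Γ -> two_ended Γ ->
  (exists N : normal_subgroup (aut Γ),
     finite_orbits N /\ (dihedral_case N \/ cyclic_case N)) /\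
  forall (N : normal_subgroup (aut Γ)) (phi : Γ -> int),
  finite_orbits N ->
  (dihedral_case N /\ isom_after_quotient N (phi : Γ -> Zdigraph)) \/
  (cyclic_case N /\ isom_after_quotient N (phi : Γ -> Zvec)) ->
  let layer (i : int) : set Γ := phi @^-1` [set i] in
  (* (a) *)
  ((dihedral_case N <->
    forall (i : int) (v : Γ), layer i v ->
      [/\ in_nbrs v `&` layer (i - 1) !=set0,
          in_nbrs v `&` layer (i + 1) !=set0,
          out_nbrs v `&` layer (i - 1) !=set0 &
          out_nbrs v `&` layer (i + 1) !=set0]) /\
   (dihedral_case N ->
    (forall (i : int) (v : Γ), layer i v ->
       out_nbrs v `&` layer (i - 1) #= out_nbrs v `&` layer (i + 1) /\
       in_nbrs v `&` layer (i - 1) #= in_nbrs v `&` layer (i + 1)) /\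
    (forall i : int,
       [/\ bipartite (induced (layer i `|` layer (i + 1))),
           vertex_transitive (induced (layer i `|` layer (i + 1))) &
           arc_transitive (induced (layer i `|` layer (i + 1)))]))) /\
  (* (b) *)
  ((cyclic_case N <->
    forall (i : int) (v : Γ), layer i v ->
      in_nbrs v `<=` layer (i - 1) /\ out_nbrs v `<=` layer (i + 1)) /\
   (cyclic_case N ->
    forall i : int,
      [/\ bipartite (induced (layer i `|` layer (i + 1))),
          arc_transitive (induced (layer i `|` layer (i + 1))) &
          forall x y : induced (layer i `|` layer (i + 1)), is_arc x y ->
            layer i (val x) /\ layer (i + 1) (val y)])) /\
  (* (c) *)
  (forall v : Γ, in_nbrs v #= out_nbrs v) /\
  (* (d) *)
  (forall d : nat, has_out_valency Γ d -> odd d -> property_Z Γ) /\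
  (* (e) *)
  (two_arc_transitive Γ ->
   digraph_isomorphic (quotient_digraph N) Zvec /\ property_Z Γ) /\
  (* (f) *)
  (locally_quasi_primitive Γ ->
   forall v : Γ, ~~ (stabilizer v #<= `I_2) -> property_Z Γ) /\
  (* (g) *)
  (has_out_valency Γ 2 ->
   forall v : Γ, ~~ (stabilizer v #<= `I_2) -> property_Z Γ).
Proof.
move=> vt at_ te; split; first exact: two_ended_quotient.
have [conn _] := te.
move=> N phi fin cases layer.
have fibre u v : phi u = phi v <-> aut_orbit N u v.
  by case: cases => -[_ phiN]; apply: (quotient_fibre phiN).
have block (g : aut Γ) u v : phi (g u) = phi (g v) <-> phi u = phi v.
  by case: cases => -[_ phiN]; apply: (quotient_block phiN).
have surj i : exists v, phi v = i.
  by case: cases => -[_ phiN]; apply: (quotient_surj phiN (i : int)).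
(* The two cases exclude each other, so [phi] has the target that matches the case at hand. *)
have toZ : dihedral_case N -> isom_after_quotient N (phi : Γ -> Zdigraph).
  by move=> dih; case: cases => -[] // /(dihedral_cyclic_excl dih).
have toZvec : cyclic_case N -> isom_after_quotient N (phi : Γ -> Zvec).
  by move=> cyc; case: cases => -[] // /dihedral_cyclic_excl/(_ cyc).
have dih_or_cyc : dihedral_case N \/ cyclic_case N by case: cases => -[]; auto.
have cyc_arc u w : cyclic_case N -> is_arc u w -> phi w = phi u + 1.
  move=> /toZvec phiN uw.
  exact/eqP/(quotient_arc phiN (phi u) (phi w)).2/(ex_intro _ u (ex_intro _ w
    (And3 erefl erefl uw))).
have arc_step u w : is_arc u w -> phi w = phi u + 1 \/ phi w = phi u - 1.
  move=> uw; case: dih_or_cyc => [/toZ phiN|cyc]; first exact: (phi_arc phiN).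
  by left; apply: cyc_arc.
have cyc_Z : cyclic_case N -> property_Z Γ.
  move=> cyc; split=> //; exists (phi : Γ -> Zvec); split.
    by move=> u v /(cyc_arc _ _ cyc) /eqP.
  by apply/seteqP; split=> // i _; have [v vi] := surj i; exists v.
split; [|split; [|split; [|split; [|split; [|split]]]]].
- split; [split|].
  + move=> /toZ phiN i v vi; have {}vi : phi v = i by [].
    rewrite -vi; split.
    * by have [w] := phi_in phiN (u := v) (or_intror erefl); exists w.
    * by have [w] := phi_in phiN (u := v) (or_introl erefl); exists w.
    * by have [w] := phi_out phiN (u := v) (or_intror erefl); exists w.
    by have [w] := phi_out phiN (u := v) (or_introl erefl); exists w.
  + move=> nb; case: dih_or_cyc => // cyc; have [v v0] := surj 0.
    have [_ _ [w [/(cyc_arc _ _ cyc)]]] := nb 0 v v0.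
    by rewrite /layer /= => -> ; rewrite v0.
  move=> /toZ phiN; split=> [i v vi|i].
    have {}vi : phi v = i by [].
    by rewrite /layer -vi; split;
      [apply: reflection_out_card phiN _ | apply: reflection_in_card phiN _].
  have arcW := layers_arc_transitive at_ block arc_step (i := i).
  split=> //; first exact: layers_bipartite.
  move=> x y _ _.
  (* Every vertex of the two layers starts an arc inside them, so arc-transitivity yields
     vertex-transitivity. *)
  have next (z : induced (layer i `|` layer (i + 1))) : exists z', is_arc z z'.
    have [zi|zi] : (layer i `|` layer (i + 1)) (val z) by apply: set_mem;
      apply: valP.
      have [w zw wE] := phi_out phiN (u := val z) (or_introl erefl).
      have wW : w \in layer i `|` layer (i + 1).
        by rewrite inE; right; rewrite /layer /= wE zi.
      by exists (SigSub wW).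
    have [w zw wE] := phi_out phiN (u := val z) (or_intror erefl).
    have wW : w \in layer i `|` layer (i + 1).
      by rewrite inE; left; rewrite /layer /= wE zi addrK.
    by exists (SigSub wW).
  have [x' xx] := next x; have [y' yy] := next y.
  by have [g [gx _]] := arcW _ _ _ _ xx yy; exists g.
- split; [split|].
  + move=> cyc i v vi; have {}vi : phi v = i by [].
    split=> w; rewrite /layer /= -vi => /(cyc_arc _ _ cyc) ->; by rewrite ?addrK.
  + move=> nb; case: dih_or_cyc => // /toZ phiN; have [v v0] := surj 0.
    have [w vw wE] := phi_out phiN (u := v) (or_intror erefl).
    by have [_ /(_ w vw)] := nb 0 v v0; rewrite /layer /= wE v0.
  move=> cyc i; split; first exact: layers_bipartite.
    exact: layers_arc_transitive.
  move=> x y xy; have xy' : phi (val y) = phi (val x) + 1 by apply: cyc_arc.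
  have : (layer i `|` layer (i + 1)) (val x) by apply: set_mem; apply: valP.
  have : (layer i `|` layer (i + 1)) (val y) by apply: set_mem; apply: valP.
  by case=> /= yE [] /= xE; rewrite /layer /= xE yE in xy' *; lia.
- move=> v; case: dih_or_cyc => [/toZ phiN|cyc].
    have [a /(_ v)[_ _ _ _ [ca cb]]] := nbrs_card vt at_ fin phiN.
    by rewrite (card_eql cb) (card_eqr ca).
  (* With [w] in the next layer, all out-neighbours of [v] lie in the layer of [w] and all
     in-neighbours of [w] in that of [v], so double counting compares whole valencies. *)
  have [w wE] := surj (phi v + 1).
  have outE : out_nbrs v `&` (phi @^-1` [set phi w]) = out_nbrs v.
    by apply/setIidPl => x /(cyc_arc _ _ cyc) /=; rewrite wE.
  have inE : in_nbrs w `&` (phi @^-1` [set phi v]) = in_nbrs w.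
    by apply/setIidPl => x /(cyc_arc _ _ cyc) /=; rewrite wE => /addIr.
  have := out_in_layer_card vt fin fibre block v w; rewrite outE inE => c.
  rewrite (card_eql (nbrs_card_vertex vt v w).1); exact: card_esym.
- move=> d val_d odd_d; case: dih_or_cyc => [/toZ phiN|/cyc_Z //].
  have [v _] := surj 0; have [a /(_ v)[_ _ _ _ [ca _]]] := nbrs_card vt at_ fin
    phiN.
  have : d = (a + a)%N by apply/card_eq_II; rewrite -(card_eql (val_d v)).
  by move=> da; rewrite da addnn odd_double in odd_d.
- move=> at2; case: dih_or_cyc => [/toZ phiN|cyc]; last by split;
    [case: cyc | apply: cyc_Z].
  have [u _] := surj 0; have [v uv vE] := phi_out phiN (u := u) (or_introl erefl).
  have [w vw wE] := phi_out phiN (u := v) (or_introl erefl).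
  have [w' vw' w'E] := phi_out phiN (u := v) (or_intror erefl).
  (* The 2-arc [u, v, w] climbs while [u, v, w'] returns to the layer of [u]; as layers are blocks,
     no automorphism maps one to the other. *)
  have [g [gu gv gw]] := at2 _ _ _ _ _ _ uv vw uv vw'.
  have : phi w = phi u by apply/(block g); rewrite gw gu w'E vE addrK.
  by rewrite wE vE; lia.
- move=> [_ lqp] v; case: dih_or_cyc => [/toZ phiN|/cyc_Z //] /negP[].
  apply: (stabilizer_card_le2 conn phiN) => {v} g v gv g_phi.
  (* This normal subgroup of the stabiliser preserves every layer. The neighbours of [v] occupy two
     layers, so it is not transitive on them and must act trivially. *)
  pose M : set (aut Γ) := [set h | h v = v /\ forall u, phi (h u) = phi u].
  have MV h : M h -> M h^-1%g.
    move=> [hv h_phi]; split; first by rewrite -{1}hv; exact: autVK.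
    by move=> u; rewrite -{2}(autKV h u) h_phi.
  have M_normal : is_normal_in M (stabilizer v).
    split; first by move=> h [].
    - split; first by rewrite inE; split.
      move=> x y; rewrite !inE => -[xv x_phi] /MV[yv y_phi]; split=> [|u].
        by rewrite -[RHS]xv -{2}yv.
      by rewrite -[RHS]y_phi -[RHS]x_phi.
    move=> x y [xv x_phi] yv; split.
      by rewrite /conjg -[RHS](autVK y v) yv -{2}xv -{2}yv.
    by move=> u; rewrite -[in RHS](autVK y u); apply/(block y^-1%g); apply: x_phi.
  have Mg : M g by split.
  have [in_qp out_qp] := lqp v.
  have trivial_nbrs (X : set Γ) w w' : X w -> X w' ->
      phi w = phi v + 1 -> phi w' = phi v - 1 ->
      quasi_primitive_on (stabilizer v) X -> trivial_on M X.
    move=> Xw Xw' wE w'E [_ /(_ M M_normal)[//|trans]].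
    have [h [_ h_phi] hw] := trans w w' Xw Xw'.
    by have := h_phi w; rewrite hw wE w'E; lia.
  move=> u /orP[vu|uv].
    have [w vw wE] := phi_out phiN (u := v) (or_introl erefl).
    have [w' vw' w'E] := phi_out phiN (u := v) (or_intror erefl).
    exact: (trivial_nbrs _ w w' vw vw' wE w'E out_qp).
  have [w vw wE] := phi_in phiN (u := v) (or_introl erefl).
  have [w' vw' w'E] := phi_in phiN (u := v) (or_intror erefl).
  exact: (trivial_nbrs _ w w' vw vw' wE w'E in_qp).
- move=> val_2 v; case: dih_or_cyc => [/toZ phiN|/cyc_Z //] /negP[].
  apply: (stabilizer_card_le2 conn phiN) => {v} g v gv g_phi.
  have [a /(_ v)[c1 c2 c3 c4 [ca _]]] := nbrs_card vt at_ fin phiN.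
  (* Valency 2 leaves one neighbour of each kind in each adjacent layer, and an element of the
     stabiliser that preserves the layers fixes it. *)
  have a1 : a = 1%N.
    suff : (2 = a + a)%N by lia.
    by apply/card_eq_II; rewrite -(card_eql (val_2 v)).
  rewrite {}a1 {ca} in c1 c2 c3 c4.
  move=> u /orP[vu|uv].
    have vgu : is_arc v (g u) by rewrite -{1}gv aut_arc.
    by case: (arc_step _ _ vu) => uE;
      [apply: card_I1_eq c2 _ _ | apply: card_I1_eq c1 _ _];
      split; rewrite //= ?g_phi.
  have guv : is_arc (g u) v by rewrite -{1}gv aut_arc.
  have uE : phi u = phi v + 1 \/ phi u = phi v - 1.
    by case: (arc_step _ _ uv) => ->; [right | left]; ring.
  by case: uE => uE; [apply: card_I1_eq c4 _ _ | apply: card_I1_eq c3 _ _];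
    split; rewrite //= ?g_phi.
Qed.
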